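(* Let $X$ be a nonempty compact metric space. The set $\Delta(X)$ consists of a single measure if and only if $X$ is quasi-nilpotent.
   Context: For a compact metric space $(X,d)$ let $X^{(1)}$ be the set of orbits of points of $X$ under the group $\mathrm{Iso}(X)$ of all isometries of $X$ onto $X$, and let $\pi_X^{(1)}\colon X\to X^{(1)}$ be the canonical projection. Let $d^{(1)}$ be the greatest pseudometric on $X^{(1)}$ for which $\pi_X^{(1)}\colon(X,d)\to(X^{(1)},d^{(1)})$ is nonexpansive; since $X$ is compact, $d^{(1)}$ is a metric and $(X^{(1)},d^{(1)})$ is a compact metric space. Put $(X^{(0)},d^{(0)})=(X,d)$ and $(X^{(n)},d^{(n)})=\bigl((X^{(n-1)})^{(1)},(d^{(n-1)})^{(1)}\bigr)$ for $n>0$. Let $\delta(Y)$ denote the diameter of a metric space $Y$. The compact metric space $X$ is called quasi-nilpotent if $\lim_{n\to\infty}\delta(X^{(n)})=0$. For a nonempty compact metric space $(X,d)$ let $\mathrm{Prob}(X)$ be the set of all Borel probability measures on $X$ with the Kantorovich metric $$\widehat d(\mu,\nu)=\sup\Bigl\{\Bigl|\int_X f\,d\mu-\int_X f\,d\nu\Bigr| : f\colon X\to\mathbb{R},\ |f(x)-f(y)|\le d(x,y)\ \text{for all } x,y\in X\Bigr\};$$ it is compact and affinely isometric to a convex subset of a normed linear space. For a convex subset $K$ of a normed linear space (or a space affinely isometric to one) let $\mathrm{Fix}(K)$ be the set of all points of $K$ fixed by every affine isometry of $K$ onto $K$; this is again a convex set (with the restricted metric). Put $\mathrm{Fix}^0(K):=K$,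 $\mathrm{Fix}^n(K):=\mathrm{Fix}(\mathrm{Fix}^{n-1}(K))$ for $n>0$, $\mathrm{Fix}^\infty(K):=\bigcap_{n=0}^\infty\mathrm{Fix}^n(K)$, and $\Delta(X):=\mathrm{Fix}^\infty(\mathrm{Prob}(X))$. *)

(* Defs.v *)
From HB Require Import structures.
From mathcomp Require Import all_boot all_order all_algebra.
From mathcomp Require Import all_classical all_reals all_analysis.

Set Implicit Arguments.
Unset Strict Implicit.
Unset Printing Implicit Defensive.

Import Order.TTheory GRing.Theory Num.Theory.
Import numFieldNormedType.Exports.

Local Open Scope classical_set_scope.
Local Open Scope ring_scope.
Local Open Scope convex_scope.

(* A nonempty metric space: measurable types of the library are pointed, so
   nonemptiness is carried by the (otherwise irrelevant) base point. *)
#[short(type="pointedMetricType")]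
HB.structure Definition PointedMetric (K : numDomainType) :=
  {M of Pointed M & Metric K M}.

Definition pseudometric (R : realType) (T : Type) (rho : T -> T -> R) : Prop :=
  [/\ forall x, rho x x = 0,
      forall x y, rho x y = rho y x &
      forall x y z, rho x z <= rho x y + rho y z].

Lemma pseudometric_ge0 (R : realType) (T : Type) (rho : T -> T -> R) x y :
  pseudometric rho -> 0 <= rho x y.
Proof.
case=> r0 rC rD; rewrite -(@pmulrn_lge0 _ _ 2)// -(r0 x).
by rewrite (le_trans (rD _ y _))// (rC y) -mulr2n.
Qed.

Record pmSpace (R : realType) := PmSpace {
  pm_sort :> Type ;
  pm_dist : pm_sort -> pm_sort -> R ;
  pm_distP : pseudometric pm_dist }.

Arguments pm_dist {R p}.

Section orbit_space.
Variables (R : realType) (Y : pmSpace R).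

Definition isometry_onto (g : Y -> Y) : Prop :=
  (forall x y, pm_dist (g x) (g y) = pm_dist x y) /\ bijective g.

Definition iso_orbit (x : Y) : set Y := [set g x | g in isometry_onto].

Definition orbit_space : Type := {A : set Y | exists x, A = iso_orbit x}.

Definition orbit_proj (x : Y) : orbit_space :=
  exist _ (iso_orbit x) (ex_intro _ x erefl).

Definition nonexpansive_proj (rho : orbit_space -> orbit_space -> R) : Prop :=
  forall x y, rho (orbit_proj x) (orbit_proj y) <= pm_dist x y.

(* The greatest pseudometric making [orbit_proj] nonexpansive is the pointwise
   supremum of all of them; see [orbit_distP], [orbit_dist_nonexpansive] and
   [orbit_dist_greatest]. *)
Definition orbit_dist (A B : orbit_space) : R :=
  sup [set rho A B | rho in [set rho | pseudometric rho /\
                                       nonexpansive_proj rho]].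

Lemma orbit_projP (A : orbit_space) : exists x, A = orbit_proj x.
Proof. by case: A => A [x Ax]; exists x; exact: eq_exist. Qed.

Let dists (A B : orbit_space) :=
  [set rho A B | rho in [set rho | pseudometric rho /\ nonexpansive_proj rho]].

Let dists_proj x y : ubound (dists (orbit_proj x) (orbit_proj y)) (pm_dist x y).
Proof. by move=> _ [rho [_ rho1] <-]. Qed.

Let dists_neq0 A B : dists A B !=set0.
Proof.
exists 0, (fun _ _ => 0) => //; split; first by split=> // *; rewrite addr0.
by move=> x y; exact/pseudometric_ge0/pm_distP.
Qed.

Let dists_sup A B : has_sup (dists A B).
Proof.
split; first exact: dists_neq0.
have [x ->] := orbit_projP A; have [y ->] := orbit_projP B.
by exists (pm_dist x y); exact: dists_proj.
Qed.

Lemma orbit_dist_greatest (rho : orbit_space -> orbit_space -> R) :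
  pseudometric rho -> nonexpansive_proj rho ->
  forall A B, rho A B <= orbit_dist A B.
Proof.
move=> rhoP rho1 A B; apply: ub_le_sup; last by exists rho.
by have [] := dists_sup A B.
Qed.

Lemma orbit_dist_nonexpansive : nonexpansive_proj orbit_dist.
Proof. move=> x y; apply: ge_sup; [exact: dists_neq0|exact: dists_proj]. Qed.

Lemma orbit_distP : pseudometric orbit_dist.
Proof.
split=> [A|A B|A B C].
- apply/eqP; rewrite eq_le; apply/andP; split.
    apply: ge_sup => [|_ [rho [[r0 _ _] _] <-]]; first exact: dists_neq0.
    by rewrite r0.
  apply: ub_le_sup; first by have [] := dists_sup A A.
  have [_ [rho [rP r1] _]] := dists_neq0 A A.
  by exists rho => //; case: rP.
- by congr sup; apply/seteqP; split=> _ [rho [rP r1] <-];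
    exists rho => //; case: rP => _ ->.
- apply: ge_sup => [|_ [rho [rP r1] <-]]; first exact: dists_neq0.
  have [_ _ rD] := rP.
  by rewrite (le_trans (rD _ B _))// lerD// orbit_dist_greatest.
Qed.

Definition orbit_pmSpace : pmSpace R := PmSpace orbit_distP.

Definition pm_diam : \bar R :=
  ereal_sup [set (pm_dist x y)%:E | x in [set: Y] & y in [set: Y]].

End orbit_space.

Section quasi_nilpotent.
Variables (R : realType) (X : metricType R).

Lemma mdist_pseudometric : pseudometric (@mdist R X).
Proof.
split=> [x|x y|x y z]; [exact: mdistxx|exact: metric_sym|].
exact: metric_triangle.
Qed.

(* For compact [X] all the pseudometric spaces [iter_orbit n] are metric. *)
Definition iter_orbit (n : nat) : pmSpace R :=
  iter n (@orbit_pmSpace R) (PmSpace mdist_pseudometric).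

Definition quasi_nilpotent : Prop :=
  pm_diam (iter_orbit n) @[n --> \oo] --> 0%E.

End quasi_nilpotent.

Section probability_convex.
Context d (T : measurableType d) (R : realType).
Local Open Scope ereal_scope.

Section mixture.
Variables (t : {i01 R}) (mu nu : probability T R).

Definition mixture (A : set T) : \bar R :=
  t%:num%:E * mu A + (1 - t%:num)%R%:E * nu A.

Let t0 : (0 <= t%:num)%R. Proof. by []. Qed.

Let t10 : (0 <= 1 - t%:num)%R. Proof. by rewrite subr_ge0. Qed.

Let mixtureE :
  mixture = measure_add (mscale (NngNum t0) mu) (mscale (NngNum t10) nu).
Proof. by apply/funext => A; rewrite measure_addE. Qed.

Let mixture0 : mixture set0 = 0.
Proof. by rewrite /mixture !measure0 !mule0 adde0. Qed.

Let mixture_ge0 A : 0 <= mixture A.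
Proof. by rewrite /mixture adde_ge0// mule_ge0// lee_fin. Qed.

Let mixture_sigma_additive : semi_sigma_additive mixture.
Proof. by rewrite mixtureE; exact: measure_semi_sigma_additive. Qed.

HB.instance Definition _ := isMeasure.Build _ _ _ mixture
  mixture0 mixture_ge0 mixture_sigma_additive.

Let mixture_setT : mixture setT = 1.
Proof.
by rewrite /mixture !probability_setT !mule1 -EFinD subrKC.
Qed.

HB.instance Definition _ :=
  Measure_isProbability.Build _ _ _ mixture mixture_setT.

Definition pmixture : probability T R := mixture.

End mixture.

Lemma probability_eq (mu nu : probability T R) :
  (mu : set T -> \bar R) = nu -> mu = nu.
Proof.
move: mu nu => [m [[a b] [c] [e] [f] [g] [h] [i]]].
move=> [m' [[+ +] [+] [+] [+] [+] [+] [+]]] /= mm'.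
rewrite -{}mm' => a' b' c' e' f' g' h' i'.
rewrite (Prop_irrelevance a' a) (Prop_irrelevance b' b).
rewrite (Prop_irrelevance c' c) (Prop_irrelevance e' e).
rewrite (Prop_irrelevance f' f) (Prop_irrelevance g' g).
by rewrite (Prop_irrelevance h' h) (Prop_irrelevance i' i).
Qed.

Let pmixture1 mu nu : pmixture 1%R%:i01 mu nu = mu.
Proof.
apply: probability_eq; apply/funext => A /=.
by rewrite /mixture/= subrr mul1e mul0e adde0.
Qed.

Let pmixturemm t mu : pmixture t mu mu = mu.
Proof.
apply: probability_eq; apply/funext => A /=; rewrite /mixture.
by rewrite -ge0_muleDl ?lee_fin ?subr_ge0// -EFinD subrKC mul1e.
Qed.

Let pmixtureC t mu nu : pmixture t mu nu = pmixture (1 - t%:inum)%R%:i01 nu mu.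
Proof.
apply: probability_eq; apply/funext => A /=.
by rewrite /mixture/= subKr addeC.
Qed.

Let pmixtureA : convex_quasi_associative pmixture.
Proof.
move=> p q r s a b c prs spq; apply: probability_eq; apply/funext => A /=.
rewrite /mixture/=.
rewrite !ge0_muleDr ?mule_ge0 ?lee_fin ?subr_ge0//.
rewrite !muleA -!EFinM addeA; congr (_%:E * _ + _%:E * _ + _%:E * _).
- by rewrite mulrC.
- exact: ConvexQuasiAssoc.pq_sr.
- by [].
Qed.

HB.instance Definition _ := isConvexSpace.Build R (probability T R)
  pmixture1 pmixturemm pmixtureC pmixtureA.

End probability_convex.

Section affine_isometries.
Variables (R : realType) (C : convType R) (dist : C -> C -> R).

(* Affine isometries of [K] onto [K] are represented by maps of the ambient
   space, of which only the restriction to [K] matters. *)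
Definition affine_isometry_onto (K : set C) (phi : C -> C) : Prop :=
  [/\ phi @` K = K,
      forall x y, K x -> K y -> dist (phi x) (phi y) = dist x y &
      forall (t : {i01 R}) x y, K x -> K y ->
        phi (x <| t |> y) = phi x <| t |> phi y].

Definition Fix (K : set C) : set C :=
  [set x | K x /\ forall phi, affine_isometry_onto K phi -> phi x = x].

Definition Fix_infty (K : set C) : set C := \bigcap_n iter n Fix K.

End affine_isometries.

Definition borel (R : realType) (X : pointedMetricType R) :=
  g_sigma_algebraType (@open X).

Section Delta.
Variables (R : realType) (X : pointedMetricType R).

(* Library measures are total functions on [set X] with unconstrained values on
   nonmeasurable sets.  Fixing these to be 0 makes Leibniz equality on [Prob]
   coincide with equality of measures on Borel sets. *)
Definition Prob : set (probability (borel X) R) :=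
  [set mu | forall A : set (borel X), ~ measurable A -> mu A = 0%E].

Definition kantorovich (mu nu : probability (borel X) R) : R :=
  sup [set `| \int[mu]_x f x - \int[nu]_x f x | | f in
    [set f : borel X -> R | forall x y : X, `|f x - f y| <= mdist x y]].

Definition Delta : set (probability (borel X) R) :=
  Fix_infty kantorovich Prob.

End Delta.

Arguments Prob {R} X.
Arguments Delta {R} X.

(* Main.v *)
Require Import Defs.
From HB Require Import structures.
From mathcomp Require Import all_boot all_order all_algebra.
From mathcomp Require Import ring lra.
From mathcomp Require Import all_classical all_reals all_analysis.
From mathcomp Require Import measurable_realfun.
From Stdlib Require List.

(** A state of a compact metric space [Y] is a positive unital linear functional
    on its Lipschitz functions.  By the Riesz theorem [Prob X] is, affinely and
    isometrically for the Kantorovich metric, the set of states of [X].  If a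
    convex set [K] is in this sense the set of states of [Y], its extreme points
    are the Dirac states, so its affine isometries are induced by the isometries
    of [Y], and [Fix K] is the set of isometry-invariant states.  Averaging a
    Lipschitz function over the isometry group keeps its Lipschitz constant and
    its value under every invariant state; hence [Fix K] is the set of states of
    the orbit space of [Y].  By induction the n-th iterate of [Fix] at [Prob X]
    is the set of states of [X^(n)], whose diameter is comparable to that of
    [X^(n)], and [Delta X] is a decreasing intersection of compact sets. *)

Set Implicit Arguments.
Unset Strict Implicit.
Unset Printing Implicit Defensive.

Import Order.TTheory GRing.Theory Num.Theory.
Import numFieldNormedType.Exports.

Local Open Scope classical_set_scope.
Local Open Scope ring_scope.

(** Three classical tools are replaced. Haar integration: the averaging operator is an invariant
    element, found by a fixed-point argument, of the convex set of operators sharing the closed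
    properties of Haar averaging. The Krein-Milman theorem: that an affine isometry is determined by
    its values at Dirac states is shown quantitatively, by splitting off from any state a uniformly
    positive mass located near one point. Topologies on function spaces, isometry groups and state
    spaces: compactness arguments take pointwise limits along an ultrafilter and upgrade them to
    uniform ones by equi-Lipschitz estimates. Lipschitz rather than continuous functions are tested
    because the orbit distance is the greatest nonexpansive pseudometric: an invariant function
    descends with its Lipschitz constant, so the Kantorovich formula passes unchanged to the orbit
    space. The induction treats abstract convex sets: affine isometries of [Fix K] need not extend
    to [K], so they are recomputed from the representation of [Fix K] itself. The ambient distance
    stays the same while [Y] changes at each stage. *)

Section ultrafilters.

(** * Ultrafilter limits and finite nets *)

Lemma ultra_fmap (T U : Type) (f : T -> U) (F : set_system T) :
  UltraFilter F -> UltraFilter (f @ F).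
Proof.
move=> FU; split=> [|G GF sFG]; first exact: fmap_proper_filter.
apply/predeqP => A; split=> [GA|]; last exact: sFG.
have [//|FnA] := in_ultra_setVsetC (f @^-1` A) FU.
have GnA : G (~` A) by apply: sFG.
by have /filter_ex[? []] : G (A `&` ~` A) by exact: filterI.
Qed.

Lemma ultra_bounded_cvg (R : realType) (I : Type) (F : set_system I)
    (u : I -> R) (B : R) :
  UltraFilter F -> (forall i, `|u i| <= B) ->
    exists l : R, u i @[i --> F] --> l.
Proof.
move=> FU uB; have := @segment_compact R (- B) B; rewrite compact_ultra.
move=> /(_ (u @ F) (ultra_fmap u FU)) -[|l [_ ul]]; last by exists l.
by apply: (@filterE _ F) => i /=; rewrite in_itv/= -ler_norml.
Qed.

Lemma near_cvg_dist (R : realType) (I : Type) (F : set_system I)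
    (FF : Filter F) (u : I -> R) (l e : R) :
  u i @[i --> F] --> l -> 0 < e -> \forall i \near F, `|u i - l| < e.
Proof.
move=> /cvgrPdist_lt ul e0; have := ul _ e0; apply: filterS => i.
by rewrite distrC.
Qed.

(* A filter generated by the complements of finite unions of the sets [Q t]
   would otherwise extend to an ultrafilter without a limit. *)
Lemma ultra_finite_net (T : Type) (Q : T -> T -> Prop) :
  (forall F : set_system T, UltraFilter F -> exists t, F (Q t)) ->
  exists s : seq T, forall x, exists t, List.In t s /\ Q t x.
Proof.
move=> QF; apply: contrapT => /forallNP nets.
pose B (s : seq T) := [set x | forall t, List.In t s -> ~ Q t x].
have : ProperFilter (filter_from [set: seq T] B).
  apply: filter_from_proper; first apply: filter_from_filter.
  - by exists nil.
  - move=> s t _ _; exists (s ++ t) => // x Bx.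
    by split=> y ys; apply: Bx; apply: List.in_or_app; [left|right].
  - move=> s _; have /existsNP[x xs] := nets s; exists x => t ts Qt.
    by apply: xs; exists t.
move=> /ultraFilterLemma[F [FU BF]].
have [t Ft] := QF F FU.
have FnQ : F (B [:: t]) by apply: BF; exists [:: t].
have [x [Qtx]] := filter_ex (filterI Ft FnQ).
by move/(_ t); apply => //; left.
Qed.

(** Turns a failure at infinitely many [n] into one that holds for almost every [n] along an
    ultrafilter finer than the tails. *)
Lemma ultra_eventually (A : set nat) : (forall N, exists2 n, (N <= n)%N &
  A n) ->
  exists F : set_system nat, [/\ UltraFilter F, F A &
    forall N, F [set n | (N <= n)%N]].
Proof.
move=> Ainf.
have : ProperFilter (filter_from [set: nat] (fun N => A `&` [set n | (N <=
  n)%N])).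
  apply: filter_from_proper; first apply: filter_from_filter.
  - by exists 0%N.
  - move=> i j _ _; exists (maxn i j) => // n [An] /=.
    by rewrite geq_max => /andP[].
  - by move=> N _; have [n Nn An] := Ainf N; exists n.
move=> /ultraFilterLemma[F [FU FS]]; exists F; split => //.
- by apply: FS; exists 0%N => // n [].
- by move=> N; apply: FS; exists N => // n [].
Qed.

Lemma ultra_nat : exists F : set_system nat, UltraFilter F /\
  forall N, F [set n | (N <= n)%N].
Proof.
have [N|F [FU _ FN]] := @ultra_eventually setT; last by exists F.
by exists N.
Qed.

End ultrafilters.

(** * Lipschitz functions on compact pseudometric spaces *)

Section pm_spaces.
Variables (R : realType) (Y : pmSpace R).
Implicit Types (f g h : Y -> R) (x y z : Y).
Local Notation d := (@pm_dist R Y).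

Lemma pmxx x : d x x = 0. Proof. by case: (pm_distP Y). Qed.

Lemma pmC x y : d x y = d y x. Proof. by case: (pm_distP Y). Qed.

Lemma pmD x y z : d x z <= d x y + d y z. Proof. by case: (pm_distP Y). Qed.

Lemma pm_ge0 x y : 0 <= d x y. Proof. exact/pseudometric_ge0/pm_distP. Qed.

Lemma pm_dist_diff x y x' y' : `|d x y - d x' y'| <= d x x' + d y y'.
Proof.
rewrite ler_norml; apply/andP; split.
- rewrite lerBrDl; have := pmD x' x y'; have := pmD x y y'.
  by rewrite (pmC x' x); lra.
- have := pmD x x' y; have := pmD x' y' y; rewrite (pmC y' y); lra.
Qed.

(** Orbit spaces carry only a pseudometric by construction, and a pointwise limit of isometries need
    not be bijective unless points are separated; so separation travels through the induction
    together with compactness. *)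
Definition pm_definite := forall x y, d x y = 0 -> x = y.

(** The index type is arbitrary, so the notion applies to any family without a topology on [Y] and
    passes to quotients by lifting representatives. *)
Definition ultra_compact := forall (I : Type) (F : set_system I) (u : I -> Y),
  UltraFilter F -> exists y, forall e : R, 0 < e ->
    \forall i \near F, d (u i) y < e.

Definition lip_le (L : R) f := forall x y, `|f x - f y| <= L * d x y.

Definition lip f := exists2 L, 0 <= L & lip_le L f.

Lemma lip_leW L f : lip_le L f -> lip f.
Proof.
move=> fL; exists (Num.max L 0); first by rewrite le_max lexx orbT.
move=> x y; apply: (le_trans (fL x y)).
by apply: ler_wpM2r; rewrite ?pm_ge0// le_max lexx.
Qed.

Lemma lip_le_dist x : lip_le 1 (d x).
Proof.
by move=> y z; rewrite mul1r (le_trans (pm_dist_diff _ _ _ _))// pmxx add0r.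
Qed.

Lemma lip_dist x : lip (d x).
Proof. exact: lip_leW (@lip_le_dist x). Qed.

Lemma lip_cst (a : R) : lip (fun=> a).
Proof. by exists 0 => // x y; rewrite subrr normr0 mul0r. Qed.

Lemma lip_leD L M f g : lip_le L f -> lip_le M g ->
  lip_le (L + M) (fun x => f x + g x).
Proof.
move=> fL gM x y; rewrite opprD addrACA mulrDl.
by rewrite (le_trans (ler_normD _ _))// lerD.
Qed.

Lemma lipD f g : lip f -> lip g ->
  lip (fun x => f x + g x).
Proof.
by move=> [L L0 fL] [M M0 gM]; exact: lip_leW (lip_leD fL gM).
Qed.

Lemma lip_leZ a L f : lip_le L f ->
  lip_le (`|a| * L) (fun x => a * f x).
Proof.
by move=> fL x y; rewrite -mulrBr normrM -mulrA ler_wpM2l.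
Qed.

Lemma lipZ a f : lip f -> lip (fun x => a * f x).
Proof. by move=> [L L0 fL]; exact: lip_leW (lip_leZ a fL). Qed.

Lemma lipN f : lip f -> lip (fun x => - f x).
Proof.
by move=> /(lipZ (-1)); under [X in lip X]eq_fun do rewrite mulN1r.
Qed.

Lemma lipB f g : lip f -> lip g ->
  lip (fun x => f x - g x).
Proof. by move=> lf /lipN; exact: lipD. Qed.

Lemma lip_sum (T : Type) (s : seq T) (F : T -> Y -> R) :
  (forall t, lip (F t)) -> lip (fun x => \sum_(t <- s) F t x).
Proof.
move=> lF; elim: s => [|t s ih].
  by under eq_fun do rewrite big_nil; exact: lip_cst.
by under eq_fun do rewrite big_cons; exact: lipD.
Qed.

Lemma lip_comp (phi : R -> R) f :
  (forall a b, `|phi a - phi b| <= `|a - b|) ->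
  lip f -> lip (fun x => phi (f x)).
Proof. by move=> phi1 [L L0 fL]; exists L => // x y;
  exact: le_trans (fL x y). Qed.

Lemma lip_maxr a f : lip f -> lip (fun x => Num.max a (f x)).
Proof.
apply: (@lip_comp (fun r => Num.max a r)) => b c.
have [ab|ab] := leP a b; have [ac|ac] := leP a c => //.
- by rewrite !ger0_norm; lra.
- by rewrite ler0_norm ?ler0_norm; lra.
- by rewrite subrr normr0.
Qed.

Lemma lip_minr a f : lip f -> lip (fun x => Num.min a (f x)).
Proof.
move=> /lipN/(@lip_maxr (- a))/lipN.
by under [X in lip X]eq_fun do rewrite oppr_max !opprK.
Qed.

Lemma lipM_bounded B f g : (forall x, `|f x| <= B) ->
  (forall x, `|g x| <= B) ->
  lip f -> lip g -> lip (fun x => f x * g x).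
Proof.
move=> fB gB [L L0 fL] [M M0 gM].
apply: (@lip_leW (B * M + B * L)) => x y.
have -> : f x * g x - f y * g y = f x * (g x - g y) + g y * (f x - f y) by ring.
rewrite (le_trans (ler_normD _ _))// !normrM mulrDl -!mulrA.
by apply: lerD; apply: ler_pM.
Qed.

Hypothesis Ycpt : ultra_compact.

Lemma pm_finite_net (e : R) : 0 < e ->
  exists s : seq Y, forall x, exists t, List.In t s /\ d t x < e.
Proof.
move=> e0; apply: (@ultra_finite_net _ (fun t x => d t x < e)) => F FU.
have [y /(_ _ e0) yF] := Ycpt id FU; exists y.
by move: yF; apply: filterS => x /=; rewrite pmC.
Qed.

Lemma pm_bounded : exists B, forall x y, d x y <= B.
Proof.
have [s sP] := pm_finite_net (@ltr01 R).
pose S t := \sum_(u <- s) d t u.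
have dS t u : List.In u s -> d t u <= S t.
  rewrite /S; elim: (s) => //= v r ih [->|/ih ur]; rewrite big_cons.
    by rewrite lerDl sumr_ge0// => *; exact: pm_ge0.
  by rewrite (le_trans ur)// lerDr pm_ge0.
have SS t : List.In t s -> S t <= \sum_(u <- s) S u.
  have S0 u : 0 <= S u by rewrite /S sumr_ge0// => *; exact: pm_ge0.
  elim: (s) => //= v r ih [->|/ih ur]; rewrite big_cons.
    by rewrite lerDl sumr_ge0.
  by rewrite (le_trans ur)// lerDr.
(* One unit on each side to reach the net, and the sum of all distances inside the net in
   between. *)
exists (2 + \sum_(u <- s) S u) => x y.
have [t [ts tx]] := sP x; have [u [us uy]] := sP y.
have := pmD x t y; have := pmD t u y; have := dS t u us; have := SS t ts.
rewrite (pmC x t); move: tx uy; lra.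
Qed.

Lemma lip_bounded f : lip f -> exists B, forall x, `|f x| <= B.
Proof.
move=> [L L0 fL]; have [B dB] := pm_bounded.
have [[y]|Y0] := pselect (inhabited Y); last first.
  by exists 0 => x; case: Y0; exists.
exists (`|f y| + L * B) => x; rewrite -lerBlDl (le_trans (lerB_dist _ _))//.
by rewrite (le_trans (fL x y))// ler_wpM2l.
Qed.

Lemma lipM f g : lip f -> lip g ->
  lip (fun x => f x * g x).
Proof.
move=> lf lg; have [B fB] := lip_bounded lf.
have [C gC] := lip_bounded lg.
by apply: (@lipM_bounded (Num.max B C)) => // x;
  rewrite le_max ?fB ?gC ?orbT.
Qed.

Lemma equilip_cvg_uniform (I : Type) (F : set_system I) (u : I -> Y -> R)
    f L : Filter F -> (forall i, lip_le L (u i)) -> lip_le L f ->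
  (forall x, u i x @[i --> F] --> f x) ->
  forall e : R, 0 < e -> \forall i \near F, forall x, `|u i x - f x| <= e.
Proof.
move=> FF uL fL uf e e0.
(* [L] may be zero or negative, so the net radius is taken from a positive majorant. *)
pose M := `|L| + 1; have M0 : 0 < M by rewrite ltr_wpDl.
have LM : L <= M by rewrite (le_trans (ler_norm _))// lerDl.
have eM : 0 < e / (3 * M) by rewrite divr_gt0// mulr_gt0.
have [s sP] := pm_finite_net eM.
have : \forall i \near F, forall t, List.In t s -> `|u i t - f t| < e / 3.
  elim: s {sP} => [|t s ih]; first by apply: filterE => i t.
  have e3 : 0 < e / 3 by rewrite divr_gt0.
  apply: filterS2 ih (near_cvg_dist FF (uf t) e3) => i us ut v /= [<-//|].
  exact: us.
apply: filterS => i us x; have [t [/us ut tx]] := sP x.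
have close g : lip_le L g -> `|g t - g x| <= e / 3.
  move=> /(_ t x) /le_trans; apply.
  apply: (@le_trans _ _ (M * (e / (3 * M)))).
    apply: (@le_trans _ _ (M * d t x)); first by rewrite ler_wpM2r// pm_ge0.
    by rewrite ler_wpM2l// ltW.
  by rewrite le_eqVlt; apply/orP; left; apply/eqP; field; apply: lt0r_neq0.
move: ut (close _ (uL i)) (close _ fL); rewrite !ler_norml !ltr_norml; lra.
Qed.

End pm_spaces.

Arguments ultra_compact {R} Y.
Arguments pm_definite {R} Y.

(** * States: estimates, limits, concentration of mass *)

Section states.
Variables (R : realType) (Y : pmSpace R).
Implicit Types (f g h : Y -> R) (x y z : Y) (m : (Y -> R) -> R).
Local Notation d := (@pm_dist R Y).

(** [m] is total, but its values off Lipschitz functions carry no information; states are therefore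
    always compared on [lip] functions only. *)
Record state m : Prop := State {
  stateD : forall f g, lip f -> lip g ->
    m (fun x => f x + g x) = m f + m g ;
  stateZ : forall a f, lip f -> m (fun x => a * f x) = a * m f ;
  state_ge0 : forall f, lip f -> (forall x, 0 <= f x) -> 0 <= m f ;
  state1 : m (fun=> 1) = 1 }.

Lemma state_dirac y : state (fun f => f y). Proof. by split. Qed.

Section state_theory.
Variables (m : (Y -> R) -> R) (sm : state m).

Lemma state_cst a : m (fun=> a) = a.
Proof.
have := stateZ sm a (lip_cst Y 1); by rewrite state1// mulr1.
Qed.

Lemma state_inhabited : inhabited Y.
Proof.
apply: contrapT => Y0; have : m (fun=> 1) = m (fun=> 0).
  by congr m; apply/funext => y; case: Y0; exists.
by rewrite !state_cst => /eqP; rewrite oner_eq0.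
Qed.

Lemma stateB f g : lip f -> lip g ->
  m (fun x => f x - g x) = m f - m g.
Proof.
move=> lf lg; rewrite -[X in _ = _ + X]mulN1r -stateZ// -stateD//; last first.
  exact: lipZ.
by congr m; apply/funext => x; rewrite mulN1r.
Qed.

Lemma state_le f g : lip f -> lip g -> (forall x, f x <= g x) ->
  m f <= m g.
Proof.
move=> lf lg fg; rewrite -subr_ge0 -stateB// state_ge0//.
- exact: lipB.
- by move=> x; rewrite subr_ge0.
Qed.

Lemma state_dist f g e : lip f -> lip g ->
  (forall x, `|f x - g x| <= e) -> `|m f - m g| <= e.
Proof.
move=> lf lg fge; rewrite -stateB// ler_norml -(state_cst (- e)).
rewrite -[X in _ && (_ <= X)](state_cst e); apply/andP; split; apply: state_le;
  do ?[exact: lipB|exact: lip_cst] => x;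
  by have := fge x; rewrite ler_norml => /andP[].
Qed.

Lemma state_bound f B : lip f -> (forall x, `|f x| <= B) -> `|m f| <= B.
Proof.
move=> lf fB; rewrite -(subr0 (m f)) -(state_cst 0).
apply: state_dist => // [|x]; first exact: lip_cst.
by rewrite subr0.
Qed.

Lemma state_sum (T : Type) (s : seq T) (F : T -> Y -> R) :
  (forall t, lip (F t)) ->
  m (fun x => \sum_(t <- s) F t x) = \sum_(t <- s) m (F t).
Proof.
move=> lF; elim: s => [|t s ih].
  rewrite big_nil -[RHS]state_cst; congr m.
  by apply/funext => x; rewrite big_nil.
rewrite big_cons -ih -stateD//; last exact: lip_sum.
by congr m; apply/funext => x; rewrite big_cons.
Qed.

(** [m (d y)] is the Kantorovich distance from [m] to the Dirac state at [y] (see [dist_dirac]);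
    concentration near a point is always measured by it. *)
Lemma state_at L f y : 0 <= L -> lip_le L f ->
  `|m f - f y| <= L * m (d y).
Proof.
move=> L0 fL; have lf := lip_leW fL.
rewrite -(state_cst (f y)) -stateB//; last exact: lip_cst.
rewrite -(stateZ sm); last exact: lip_dist.
have lZ : lip (fun x => L * d y x) by exact/lipZ/lip_dist.
have lfy : lip (fun x => f x - f y).
  by apply: lipB => //; exact: lip_cst.
rewrite ler_norml lerNl -mulN1r -stateZ//; apply/andP; split.
- apply: state_le => // [|x]; first exact: lipZ.
  by rewrite mulN1r opprB (le_trans (ler_norm _)).
- apply: state_le => // x.
  by rewrite (le_trans (ler_norm _))// (le_trans (fL _ _))// pmC.
Qed.

(** Conditioning on the density [p]. Applied to [p] and to [1 - p], it writes [m] as a convex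
    combination of two states with weights [m p] and [1 - m p]. *)
Lemma state_weight (Ycpt : ultra_compact Y) (p : Y -> R) : lip p ->
  (forall x, 0 <= p x) -> 0 < m p ->
  state (fun f => m (fun x => p x * f x) / m p).
Proof.
move=> lp p0 mp; split=> [f g lf lg|a f lf|f lf f0|].
- rewrite -mulrDl -(stateD sm); [|exact: lipM..].
  by congr (m _ / _); apply/funext => x; rewrite mulrDr.
- rewrite mulrA -(stateZ sm); last exact: lipM.
  by congr (m _ / _); apply/funext => x; rewrite mulrCA.
- rewrite divr_ge0// ?(ltW mp)// state_ge0//; first exact: lipM.
  by move=> x; rewrite mulr_ge0.
- under [X in m X]eq_fun do rewrite mulr1.
  by rewrite divff// gt_eqF.
Qed.

End state_theory.

Section state_limits.
Variables (I : Type) (F : set_system I) (M : I -> (Y -> R) -> R).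
Hypothesis (sM : forall i, state (M i)).

Lemma state_cvg m : ProperFilter F ->
  (forall f, lip f -> M i f @[i --> F] --> m f) -> state m.
Proof.
move=> FF Mm; split=> [f g lf lg|a f lf|f lf f0|].
- have := Mm _ (lipD lf lg).
  under eq_fun do rewrite stateD//.
  by move=> /cvg_unique; apply => //; apply: cvgD; exact: Mm.
- have := Mm _ (lipZ a lf).
  under eq_fun do rewrite stateZ//.
  by move=> /cvg_unique; apply => //; apply: cvgMr; exact: Mm.
- rewrite -(cvg_lim _ (Mm _ lf))//; apply: limr_ge.
    by apply/cvg_ex; exists (m f); exact: Mm.
  by apply: filterE => i; exact: state_ge0.
- have := Mm _ (lip_cst Y 1); under eq_fun do rewrite state1//.
  by move=> /cvg_unique; apply => //; exact: cvg_cst.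
Qed.

Hypotheses (FU : UltraFilter F) (Ycpt : ultra_compact Y).

(** The Banach-Alaoglu argument: the values of all states at a fixed bounded function lie in one
    segment. *)
Lemma state_ultra_limit : exists2 m, state m &
  forall f, lip f -> M i f @[i --> F] --> m f.
Proof.
pose m f := lim (M i f @[i --> F]).
have Mm f : lip f -> M i f @[i --> F] --> m f.
  move=> lf; have [B fB] := lip_bounded Ycpt lf.
  have MB i : `|M i f| <= B by exact: state_bound.
  have [l Ml] := ultra_bounded_cvg FU MB.
  by rewrite /m (cvg_lim _ Ml).
by exists m => //; apply: state_cvg Mm.
Qed.

(* Arzela-Ascoli: functions violating uniform convergence would, once
   normalized at a base point, have an ultrafilter limit. *)
Lemma state_cvg_uniform m : state m ->
  (forall f, lip f -> M i f @[i --> F] --> m f) ->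
  forall e : R, 0 < e -> \forall i \near F,
    forall f, lip_le 1 f -> `|M i f - m f| <= e.
Proof.
move=> sm Mm e e0.
pose A := [set i | forall f, lip_le 1 f -> `|M i f - m f| <= e].
have [//|FnA] := in_ultra_setVsetC A FU.
have [y0] := state_inhabited sm.
have ex i : exists f, [/\ lip_le 1 f, f y0 = 0 &
    ~ A i -> e < `|M i f - m f|].
  have [Ai|/existsNP[f /not_implyP[f1 /negP]]] := pselect (A i).
    exists (fun=> 0); split => //.
    by move=> x y; rewrite subrr normr0 mul1r pm_ge0.
  rewrite -ltNge => eMm; have lf := lip_leW f1.
  exists (fun x => f x - f y0); split.
  - by move=> x y; rewrite opprB addrA subrK.
  - by rewrite subrr.
  - by rewrite !stateB// ?state_cst ?opprB ?addrA ?subrK//; exact: lip_cst.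
have [u uP] := choice ex.
have [B dB] := pm_bounded Ycpt.
have uB x i : `|u i x| <= B.
  have [u1 u0 _] := uP i; rewrite -(subr0 (u i x)) -u0.
  by rewrite (le_trans (u1 _ _))// mul1r.
pose f x : R := lim (u i x @[i --> F]).
have uf x : u i x @[i --> F] --> f x.
  have [l ul] := ultra_bounded_cvg FU (uB x).
  by rewrite /f (cvg_lim _ ul).
have f1 : lip_le 1 f.
  move=> x y.
  have /cvg_norm ufxy : u i x - u i y @[i --> F] --> f x - f y by exact: cvgB.
  rewrite -(cvg_lim _ ufxy)//; apply: limr_le; first by apply/cvg_ex; eexists;
    exact: ufxy.
  by apply: filterE => i; have [u1 _ _] := uP i; exact: u1.
have lf := lip_leW f1.
have e4 : 0 < e / 4 by rewrite divr_gt0.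
have u1 i : lip_le 1 (u i) by have [] := uP i.
have FF : Filter F by exact: _.
have near1 := equilip_cvg_uniform Ycpt FF u1 f1 uf e4.
have near2 := near_cvg_dist FF (Mm f lf) e4.
have [i [[/= close1 close2] nAi]] :=
  filter_ex (filterI (filterI near1 near2) FnA).
have [_ _ /(_ nAi)] := uP i; rewrite ltNge => /negP; case.
have := state_dist (sM i) (lip_leW (u1 i)) lf close1.
have := state_dist sm (lip_leW (u1 i)) lf close1.
move: close2; rewrite !ler_norml !ltr_norml; lra.
Qed.

End state_limits.

(** Bumps around the points of an [e / 2]-net add up to at least [c0] everywhere, so one of them has
    mass bounded below independently of [m]. The cap [2^-1] on the bumps leaves positive mass to
    [1 - p]. *)
Lemma state_mass (Ycpt : ultra_compact Y) (e : R) : 0 < e ->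
  exists2 c, 0 < c & forall m, state m -> exists y p,
    [/\ lip p, forall z, 0 <= p z <= 2^-1,
        forall z, e <= d y z -> p z = 0 & c <= m p].
Proof.
move=> e0; have e2 : 0 < e / 2 by rewrite divr_gt0.
have [s sP] := pm_finite_net Ycpt e2.
pose p y z := Num.max 0 (Num.min 2^-1 (e - d y z)).
pose c0 := Num.min 2^-1 (e / 2);
  have c00 : 0 < c0 by rewrite lt_min e2 invr_gt0 andbT.
have lp y : lip (p y).
  apply/lip_maxr/lip_minr/lipB; first exact: lip_cst.
  exact: lip_dist.
have p0 y z : 0 <= p y z by rewrite le_max lexx.
have k0 : 0 < (size s).+1%:R :> R by [].
(* The successor makes the pigeonhole inequality strict and covers an empty net. *)
exists (c0 / (size s).+1%:R) => [|m sm]; first by rewrite divr_gt0.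
suff [y my] : exists y, c0 / (size s).+1%:R <= m (p y).
  exists y, (p y); split => // z.
    by rewrite p0/= ge_max invr_ge0 ler0n ge_min lexx.
  by move=> eyz; apply/max_idPl; rewrite ge_min subr_le0 eyz orbT.
apply: contrapT => /forallNP nex.
have : c0 <= \sum_(t <- s) m (p t).
  rewrite -state_sum// -(state_cst sm c0); apply: state_le => //.
  - exact: lip_cst.
  - exact: lip_sum.
  - move=> z; have [t [ts tz]] := sP z.
    apply: (@le_trans _ _ (p t z)).
      rewrite le_max le_min !ge_min lexx/=.
      by apply/orP; right; apply/orP; right; lra.
    elim: (s) ts => //= v r ih [->|/ih ur]; rewrite big_cons.
      by rewrite lerDl sumr_ge0.
    by rewrite (le_trans ur)// lerDr.
apply/negP; rewrite -ltNge.
apply: (@le_lt_trans _ _ (\sum_(t <- s) c0 / (size s).+1%:R)).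
  by apply: ler_sum => t _; have /negP := nex t; rewrite -ltNge => /ltW.
rewrite big_const_seq count_predT iter_addr_0 -[ltLHS]mulr_natr.
by rewrite mulrAC ltr_pdivrMr// ltr_pM2l// ltr_nat.
Qed.

End states.

(** * A fixed-point theorem for sets of functions *)

Section invariant_point.
Variables (R : realType) (P : Type) (D : set P) (G : set (P -> P)).
Hypotheses (Gid : G id) (Gcomp : forall a b, G a -> G b -> G (a \o b)).
Hypothesis (GD : forall a p, G a -> D p -> D (a p)).
Implicit Types (K : set (P -> R)) (E : P -> R).

(** Limits are controlled on [D] only, so membership in [K] cannot depend on values outside [D].
    Midpoints suffice as a form of convexity. *)
Record midpoint_closed_invariant K : Prop := MidpointClosedInvariant {
  mci_mid : forall E E', K E -> K E' -> K (fun p => (E p + E' p) / 2) ;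
  mci_act : forall E a, K E -> G a -> K (E \o a) ;
  mci_lim : forall (I : Type) (F : set_system I) (u : I -> P -> R) E,
    UltraFilter F -> (forall i, K (u i)) ->
    (forall p, D p -> u i p @[i --> F] --> E p) -> K E }.

Definition orbits_bounded K := forall p, D p ->
  exists B, forall E a, K E -> G a -> `|E (a p)| <= B.

(** Stands in for compactness of the group: in a compact group one takes a finite net and picks [h]
    close to [b] composed with the inverse of [a]. *)
Definition orbits_precompact K := forall p b (e : R), D p -> G b -> 0 < e ->
  exists2 s : seq (P -> P), (forall h, List.In h s -> G h) &
    forall a, G a -> exists2 h, List.In h s &
      forall E, K E -> `|E (h (a p)) - E (b p)| <= e.

Lemma midpoint_closed_limit K (I : Type) (F : set_system I) (u : I -> P -> R) :
  midpoint_closed_invariant K -> orbits_bounded K -> UltraFilter F ->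
  (forall i, K (u i)) ->
  exists2 E, K E & forall p, D p -> u i p @[i --> F] --> E p.
Proof.
move=> Kc Kb FU Ku; pose E p : R := lim (u i p @[i --> F]).
have uE p : D p -> u i p @[i --> F] --> E p.
  move=> Dp; have [B KB] := Kb p Dp.
  have uB i : `|u i p| <= B by exact: (KB _ id).
  have [l ul] := ultra_bounded_cvg FU uB.
  by rewrite /E (cvg_lim _ ul).
by exists E => //; exact: (mci_lim Kc FU Ku uE).
Qed.

(* A minimizer [E] of the supremum [v] over the orbit of [p] is constant on the
   orbit: if [E (b p) < v], averaging finitely many translates of [E] would
   decrease the supremum. *)
Lemma invariant_point1 K p : midpoint_closed_invariant K -> orbits_bounded K ->
  orbits_precompact K -> K !=set0 -> D p ->
  exists2 E, K E & forall a, G a -> E (a p) = E p.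
Proof.
move=> Kc Kb Kp [E0 KE0] Dp.
have [B KB] := Kb p Dp.
pose S := [set c | exists2 E, K E & forall a, G a -> E (a p) <= c].
pose v := inf S.
have Slb : lbound S (- B).
  move=> c [E KE Ec]; apply: le_trans (Ec _ Gid).
  by have := KB _ _ KE Gid; rewrite ler_norml => /andP[].
have hS : has_inf S.
  split; last by exists (- B).
  by exists B, E0 => // a Ga; exact: (le_trans (ler_norm _) (KB _ _ KE0 Ga)).
have appr n : exists E, K E /\ forall a, G a -> E (a p) <= v + n.+1%:R^-1.
  have n0 : 0 < n.+1%:R^-1 :> R by rewrite invr_gt0.
  have [c [E KE Ec] cv] := inf_adherent n0 hS.
  by exists E; split=> // a /Ec /le_trans; apply; exact: ltW.
have [u uP] := choice appr.
have Ku n : K (u n) by have [] := uP n.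
have [F [FU FN]] := ultra_nat.
have [E KE uE] := midpoint_closed_limit Kc Kb FU Ku.
have Ev a : G a -> E (a p) <= v.
  move=> Ga; apply/ler_addgt0Pr => e e0.
  have [N eN] : exists N, N.+1%:R^-1 <= e.
    by have [N] := ltr_add_invr e0; rewrite add0r => /ltW; exists N.
  have cva := uE _ (GD Ga Dp).
  rewrite -(cvg_lim _ cva)//; apply: limr_le; first by apply/cvg_ex; eexists;
    exact: cva.
  apply: filterS (FN N) => n /= Nn.
  rewrite (le_trans ((uP n).2 a Ga))// lerD2l (le_trans _ eN)//.
  by rewrite lef_pV2 ?posrE// ler_nat.
suff Eb b : G b -> v <= E (b p).
  exists E => // a Ga; apply: le_anti.
  by rewrite (le_trans (Ev _ Ga) (Eb _ Gid)) (le_trans (Ev _ Gid) (Eb _ Ga)).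
move=> Gb; rewrite leNgt; apply/negP => Ebv.
pose e := (v - E (b p)) / 2.
have e0 : 0 < e by rewrite divr_gt0// subr_gt0.
have [s sG sP] := Kp p b e Dp Gb e0.
have [E' KE' [t t0 E't]] : exists2 E', K E' & exists2 t, 0 < t &
    forall a, G a -> E' (a p) <= v /\
      ((exists2 h, List.In h s & E (h (a p)) <= v - e) -> E' (a p) <= v - t).
  elim: s sG {sP} => [_|h s ih hsG].
    by exists E => //; exists 1 => // a Ga; split; [exact: Ev|case].
  have [|E' KE' [t t0 E't]] := ih; first by move=> k ks; apply: hsG; right.
  have Gh : G h by apply: hsG; left.
  exists (fun q => ((E \o h) q + E' q) / 2).
    by apply: (mci_mid Kc) => //; exact: (mci_act Kc).
  (* Nested midpoints give the translates unequal weights and halve the gain at each stage; only its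
     positivity matters. *)
  exists (Num.min e t / 2); first by rewrite divr_gt0// lt_min e0.
  have mint : Num.min e t <= e /\ Num.min e t <= t by rewrite !ge_min !lexx
    orbT.
  move=> a Ga; have [E'v E'vt] := E't a Ga; have Ehv := Ev _ (Gcomp Gh Ga).
  rewrite /comp/= in Ehv *; split; first by lra.
  by move=> [k /= [<- Ek|ks Ek]]; [lra|have := E'vt (ex_intro2 _ _ k ks Ek);
    lra].
have : S (v - t).
  exists E' => // a Ga; apply: (E't a Ga).2; have [h hs hP] := sP a Ga;
    exists h => //.
  by have := hP E KE; rewrite /e ler_norml => /andP[_]; lra.
move=> /(ge_inf (proj2 hS)); rewrite -/v; lra.
Qed.

(** The elements of [K] that are invariant at finitely many points again form a set of the same
    kind, so [invariant_point1] adds one more point at a time; a limit along finite lists handles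
    all points together. *)
Theorem invariant_point K : midpoint_closed_invariant K -> orbits_bounded K ->
  orbits_precompact K -> K !=set0 ->
  exists2 E, K E & forall p a, D p -> G a -> E (a p) = E p.
Proof.
move=> Kc Kb Kp K0.
pose Kl (l : seq P) := [set E | K E /\
  forall p a, List.In p l -> D p -> G a -> E (a p) = E p].
have Klc l : midpoint_closed_invariant (Kl l).
  split=> [E E' [KE lE] [KE' lE']|E a [KE lE] Ga|I F u E FU Ku uE].
  - by split=> [|p a pl Dp Ga]; [exact: (mci_mid Kc)|rewrite lE// lE'].
  - split=> [|p b pl Dp Gb]; first exact: (mci_act Kc).
    by rewrite /= (lE p a)// -(lE p (a \o b))//; exact: Gcomp.
  - split=> [|p a pl Dp Ga]; first by apply: (mci_lim Kc FU) uE => i;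
    have [] := Ku i.
    have := uE _ (GD Ga Dp).
    under eq_fun => i do rewrite (proj2 (Ku i) p a pl Dp Ga).
    by move=> /cvg_unique; apply => //; exact: uE.
have Kln l : Kl l !=set0.
  elim: l => [|p l [E KlE]]; first by have [E KE] := K0; exists E; split.
  have [Dp|nDp] := pselect (D p); last first.
    by exists E; split=> [|q a /= [<-//|]]; [exact: KlE.1|exact: KlE.2].
  have [||||E' [KE' lE'] E'p] := @invariant_point1 (Kl l) p (Klc l) => //.
  - by move=> q /Kb[B KB]; exists B => E' a [KE' _]; exact: KB.
  - move=> q b e Dq Gb e0; have [s sG sP] := Kp q b e Dq Gb e0.
    exists s => // a /sP[h hs hP]; exists h => // E' [KE' _]; exact: hP.
  - by exists E.
  - by exists E'; split=> // q a /= [<- _ /E'p//|]; exact: lE'.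
have [u Ku] := choice Kln.
(* The ultrafilter will contain, for every [p], the set of all lists in which [p] occurs. *)
pose B (s : seq P) := [set l | forall p, List.In p s -> List.In p l].
have : ProperFilter (filter_from [set: seq P] B).
  apply: filter_from_proper; last by move=> s _; exists s.
  apply: filter_from_filter; first by exists nil.
  move=> s t _ _; exists (s ++ t) => // l Bl.
  by split=> p pl; apply: Bl; apply: List.in_or_app; [left|right].
move=> /ultraFilterLemma[F [FU BF]].
have [l|E KE uE] := midpoint_closed_limit Kc Kb FU (u := u);
  first by case: (Ku l).
exists E => // p a Dp Ga.
have Fp : F (B [:: p]) by apply: BF; exists [:: p].
apply: (@cvg_unique _ _ (u i p @[i --> F])) => //; last exact: uE.
apply: cvg_trans (uE _ (GD Ga Dp)); apply: near_eq_cvg.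
apply: filterS Fp => l Bl; rewrite (proj2 (Ku l) p a)//.
by apply: Bl; left.
Qed.

End invariant_point.

(** * The isometry group and the averaging operator *)

Section isometries.
Variables (R : realType) (Y : pmSpace R).
Implicit Types (f : Y -> R) (g h : Y -> Y) (x y z : Y).
Local Notation d := (@pm_dist R Y).

Lemma isometry_id : isometry_onto (@id Y).
Proof. by split=> //; exists id. Qed.

Lemma isometry_comp g h : isometry_onto g -> isometry_onto h ->
  isometry_onto (g \o h).
Proof.
by move=> [gd gb] [hd hb]; split=> [x y|]; [rewrite /= gd hd|exact: bij_comp].
Qed.

Lemma isometry_inv g : isometry_onto g ->
  exists h, [/\ isometry_onto h, cancel g h & cancel h g].
Proof.
move=> [gd [h gK hK]]; exists h; split=> //; split=> [x y|]; last by exists g.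
by rewrite -gd !hK.
Qed.

Lemma lip_le_isometry L f g : isometry_onto g -> lip_le L f ->
  lip_le L (f \o g).
Proof. by move=> [gd _] fL x y; rewrite (le_trans (fL _ _))// gd. Qed.

Lemma lip_isometry f g : isometry_onto g -> lip f -> lip (f \o g).
Proof. by move=> ig [L L0 fL]; exists L => //; exact: lip_le_isometry. Qed.

Definition invariant_fun f := forall g x, isometry_onto g -> f (g x) = f x.

Definition invariant_state (m : (Y -> R) -> R) :=
  forall f g, lip f -> isometry_onto g -> m (f \o g) = m f.

Lemma state_isometry m g : state m -> isometry_onto g ->
  state (fun f => m (f \o g)).
Proof.
move=> sm ig; split=> [f h lf lh|a f lf|f lf f0|]; last exact: state1.
- by rewrite -(stateD sm)//; exact: lip_isometry.
- by rewrite -(stateZ sm)//; exact: lip_isometry.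
- by apply: (state_ge0 sm) => [|x]; [exact: lip_isometry|exact: f0].
Qed.

Hypotheses (Ycpt : ultra_compact Y) (Ydef : pm_definite Y).

(** The inverses converge along the same ultrafilter, and their limit [h] inverts [g]; this gives
    bijectivity of the limit. *)
Lemma isometry_ultra_limit (I : Type) (F : set_system I) (u : I -> Y -> Y) :
  UltraFilter F -> (forall i, isometry_onto (u i)) ->
  exists2 g, isometry_onto g & forall e : R, 0 < e -> forall y,
    \forall i \near F, d (u i y) (g y) < e.
Proof.
move=> FU iu.
have /choice[v vP] : forall i, exists v, [/\ isometry_onto v, cancel (u i) v &
    cancel v (u i)] by move=> i; exact: isometry_inv.
have /choice[g ug] := fun y => Ycpt (fun i => u i y) FU.
have /choice[h vh] := fun y => Ycpt (fun i => v i y) FU.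
have gd x y : d (g x) (g y) = d x y.
  apply/eqP; rewrite -subr_eq0 -normr_le0; apply/ler_addgt0Pr => e e0;
    rewrite add0r.
  have e2 : 0 < e / 2 by rewrite divr_gt0.
  have [i [/= ux uy]] := filter_ex (filterI (ug x _ e2) (ug y _ e2)).
  rewrite -[X in _ - X](proj1 (iu i)) distrC.
  by rewrite (le_trans (pm_dist_diff _ _ _ _))//; lra.
have hK : cancel h g.
  move=> z; apply: Ydef; apply: le_anti; rewrite pm_ge0 andbT.
  apply/ler_addgt0Pr => e e0; rewrite add0r.
  have e2 : 0 < e / 2 by rewrite divr_gt0.
  have [i [/= uh vz]] := filter_ex (filterI (ug (h z) _ e2) (vh z _ e2)).
  have [_ _ vK] := vP i.
  have uz : d (u i (h z)) z = d (v i z) (h z).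
    by rewrite -{2}(vK z) (proj1 (iu i)) pmC.
  have := pmD (g (h z)) (u i (h z)) z; rewrite (pmC _ (u i _)) uz; lra.
exists g => [|e e0 y]; last exact: ug.
split=> //; exists h => // x; apply: Ydef.
by rewrite -gd hK pmxx.
Qed.

Lemma isometry_finite_net (e : R) : 0 < e ->
  exists2 s : seq (Y -> Y), (forall g, List.In g s -> isometry_onto g) &
    forall g, isometry_onto g -> exists2 k, List.In k s &
      forall y, d (k y) (g y) <= e.
Proof.
move=> e0.
pose T := {g : Y -> Y | isometry_onto g}.
have [F FU|s sP] := @ultra_finite_net T
    (fun k l => forall y, d (sval k y) (sval l y) <= e); last first.
  exists (List.map sval s) => [g|g ig].
    by move=> /List.in_map_iff[[k ik] [<- _]].
  have [k [ks kg]] := sP (exist _ g ig); exists (sval k) => //.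
  exact: List.in_map.
have [|g ig gF] := @isometry_ultra_limit T F sval FU; first by case.
exists (exist _ g ig) => /=.
have e3 : 0 < e / 3 by rewrite divr_gt0.
have [s sP] := pm_finite_net Ycpt e3.
(* Isometries close at the points of an [e / 3]-net are uniformly close. *)
have : \forall k \near F, forall t, List.In t s -> d (sval k t) (g t) < e / 3.
  elim: s {sP} => [|t s ih]; first by apply: filterE => k t.
  by apply: filterS2 ih (gF _ e3 t) => k ks kt v /= [<-//|]; exact: ks.
apply: filterS => k ks y; have [t [ts ty]] := sP y; have := ks t ts.
have := pmD (g y) (g t) (sval k y); have := pmD (g t) (sval k t) (sval k y).
rewrite (proj1 ig) (proj1 (svalP k)) (pmC (g t) (sval k t)) (pmC y); lra.
Qed.

Local Notation P := ((Y -> R) * Y)%type.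

Let D : set P := [set p | lip p.1].

Let act g h (p : P) : P := (p.1 \o g, h p.2).

(** Independent isometries act on the two coordinates, so a [G]-invariant [E] ignores translations
    of [f] and at the same time yields invariant functions of [y]. *)
Let G : set (P -> P) := [set a | exists g h,
  [/\ isometry_onto g, isometry_onto h & a = act g h]].

(** Closed convex conditions, satisfied both by Haar averaging and by plain evaluation [f y], which
    shows that the set is nonempty. Invariance of [E] is not among them: it is what the fixed-point
    theorem supplies. *)
Record averaging_operator (E : P -> R) : Prop := AveragingOperator {
  averaging_state : forall y, state (fun f => E (f, y)) ;
  averaging_fix : forall f y, lip f -> invariant_fun f -> E (f, y) = f y ;
  averaging_lip : forall L f, lip_le L f -> lip_le L (fun y => E (f, y)) ;
  averaging_invariant : forall m f, state m -> invariant_state m -> lip f ->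
    m (fun y => E (f, y)) = m f }.

Lemma averaging_dist E L f f' x y e : averaging_operator E -> lip_le L f ->
  lip f' -> (forall z, `|f z - f' z| <= e) ->
  `|E (f, x) - E (f', y)| <= L * d x y + e.
Proof.
move=> aE fL lf' ff'; have lf := lip_leW fL.
rewrite (le_trans (ler_distD (E (f, y)) _ _))// lerD//.
  exact: (averaging_lip aE fL).
exact: (state_dist (averaging_state aE y)).
Qed.

Let averaging_mci : midpoint_closed_invariant D G averaging_operator.
Proof.
split=> [E E' aE aE'|E a aE [g [h [ig ih ->]]]|I F u E FU au uE].
- split=> [y|f y lf inf|L f fL x y|m f sm im lf].
  + have sE := averaging_state aE y; have sE' := averaging_state aE' y.
    split=> [f g lf lg|a f lf|f lf f0|].
    * by rewrite (stateD sE)// (stateD sE')//; lra.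
    * by rewrite (stateZ sE)// (stateZ sE')//; lra.
    * by rewrite divr_ge0// addr_ge0// ?(state_ge0 sE)// (state_ge0 sE').
    * by rewrite (state1 sE) (state1 sE'); lra.
  + by rewrite (averaging_fix aE)// (averaging_fix aE')//; lra.
  + have := averaging_lip aE fL x y; have := averaging_lip aE' fL x y.
    by rewrite !ler_norml; lra.
  + have [L L0 fL] := lf.
    have lE := lip_leW (averaging_lip aE fL).
    have lE' := lip_leW (averaging_lip aE' fL).
    under eq_fun do rewrite mulrC.
    rewrite (stateZ sm); last exact: lipD.
    by rewrite (stateD sm)// !averaging_invariant//; lra.
- rewrite /comp/act/=; split=> [y|f y lf inf|L f fL x y|m f sm im lf] /=.
  + exact: (state_isometry (averaging_state aE (h y)) ig).
  + have ing : invariant_fun (f \o g) by move=> k x ik /=; rewrite !inf.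
    by rewrite (averaging_fix aE (h y) (lip_isometry ig lf) ing)/= !inf.
  + have := averaging_lip aE (lip_le_isometry ig fL) (h x) (h y).
    by rewrite (proj1 ih).
  + have [L L0 fL] := lip_isometry ig lf.
    have lE := lip_leW (averaging_lip aE fL).
    rewrite (im _ h lE ih) (averaging_invariant aE)//; first exact: im.
    exact: lip_isometry.
- have uL L f : lip_le L f -> lip_le L (fun y => E (f, y)).
    move=> fL x y; have lf := lip_leW fL.
    have /cvg_norm uxy : u i (f, x) - u i (f, y) @[i --> F] --> E (f, x) - E
      (f, y).
      by apply: cvgB; exact: uE.
    rewrite -(cvg_lim _ uxy)//; apply: limr_le; first by apply/cvg_ex; eexists;
      exact: uxy.
    by apply: filterE => i; exact: (averaging_lip (au i) fL).
  split=> [y|f y lf inf|//|m f sm im lf].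
  + apply: (@state_cvg _ _ I F (fun i f => u i (f, y))) => [i|f lf].
      exact: (averaging_state (au i)).
    exact: uE.
  + have := uE (f, y) lf;
    under eq_fun do rewrite (averaging_fix (au _) _ lf inf).
    by move=> /cvg_unique; apply => //; exact: cvg_cst.
  (* Pointwise limits do not pass through [m], but the functions [u i (f, _)] share a Lipschitz
     constant and hence converge uniformly. *)
  + have [L L0 fL] := lf; have FF : Filter F by exact: _.
    apply/eqP; rewrite -subr_eq0 -normr_le0; apply/ler_addgt0Pr => e e0;
      rewrite add0r.
    have uLi i : lip_le L (fun y => u i (f, y)) by exact: (averaging_lip (au
      i)).
    have [i ui] := filter_ex (equilip_cvg_uniform Ycpt FF uLi (uL _ _ fL)
      (fun y => uE (f, y) lf) e0).
    rewrite -[X in _ - X](averaging_invariant (au i) sm im lf) distrC.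
    by apply: (state_dist sm) => //;
      [exact: lip_leW (uLi i)|exact: lip_leW (uL _ _ fL)].
Qed.

Theorem averaging_exists : exists E : P -> R, [/\ averaging_operator E,
  forall f, lip f -> invariant_fun (fun y => E (f, y)) &
  forall f g y, lip f -> isometry_onto g -> E (f \o g, y) = E (f, y)].
Proof.
have Gid : G id by exists id, id; split=> //;
  [exact: isometry_id..|apply/funext => -[]].
have Gcomp a b : G a -> G b -> G (a \o b).
  move=> [g [h [ig ih ->]]] [g' [h' [ig' ih' ->]]].
  by exists (g' \o g), (h \o h'); split=> //; exact: isometry_comp.
have GD a p : G a -> D p -> D (a p).
  by move=> [g [h [ig ih ->]]]; exact: lip_isometry.
have [|||E aE Einv] := invariant_point Gid Gcomp GD averaging_mci.
- move=> [f y] lf; have [B fB] := lip_bounded Ycpt lf.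
  exists B => E _ aE [g [h [ig ih ->]]].
  apply: (state_bound (averaging_state aE _)); first exact: lip_isometry.
  by move=> x; exact: fB.
- move=> [f y] _ e lf [g0 [h0 [ig0 ih0 ->]]] e0.
  have [L L0 fL] := lf.
  (* Half of [e] pays for the change of function, half for the change of point; [L + 1] because [L]
     may vanish. *)
  have L1 : 0 < 2 * (L + 1) by rewrite mulr_gt0// ltr_wpDl.
  have [s sI sP] := isometry_finite_net (divr_gt0 e0 L1).
  exists (List.map (fun k => act k.1 k.2) (List.list_prod s s)).
    move=> a /List.in_map_iff[[k l] [<- /List.in_prod_iff[ks ls]]].
    by exists k, l; split=> //; exact: sI.
  move=> _ [g [h [ig ih ->]]].
  have [g' [ig' gK g'K]] := isometry_inv ig.
  have [h' [ih' hK h'K]] := isometry_inv ih.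
  (* [k] is close to [g' \o g0] and [l] to [h0 \o h'], so that [g \o k] is close to [g0] and
     [l (h y)] to [h0 y]; precomposition reverses the order in the first coordinate. *)
  have [k ks kP] := sP _ (isometry_comp ig' ig0).
  have [l ls lP] := sP _ (isometry_comp ih0 ih').
  exists (act k l).
    by apply/List.in_map_iff; exists (k, l); split=> //; exact/List.in_prod.
  move=> E aE; rewrite /act/=.
  have le2 (r : R) : r <= e / (2 * (L + 1)) -> L * r <= e / 2.
    move=> re; apply: (@le_trans _ _ ((L + 1) * (e / (2 * (L + 1))))).
      apply: (@le_trans _ _ (L * (e / (2 * (L + 1))))); first exact: ler_wpM2l.
      by apply: ler_wpM2r; [rewrite ltW// divr_gt0|rewrite lerDl].
    by rewrite le_eqVlt; apply/orP; left; apply/eqP; field;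
      rewrite gt_eqF// ltr_wpDl.
  have ik := sI k ks.
  apply: le_trans (averaging_dist (L := L) (e := e / 2) _ _ aE _ _ _) _.
  + exact/(lip_le_isometry ik)/(lip_le_isometry ig).
  + exact: lip_isometry.
  + move=> z /=; rewrite (le_trans (fL _ _))// le2//.
    by rewrite -(g'K (g0 z)) (proj1 ig); exact: kP.
  + by rewrite [leRHS]splitr lerD2r le2// -{2}(hK y); exact: lP.
- exists (fun p => p.1 p.2); split=> //= y; exact: state_dirac.
- exists E; split=> // [f lf g y ig|f g y lf ig].
    by have := Einv (f, y) (act id g) lf; apply; exists id, g; split=> //;
      exact: isometry_id.
  by have := Einv (f, y) (act g id) lf; apply; exists g, id; split=> //;
    exact: isometry_id.
Qed.

End isometries.

(** * Convex sets represented as state spaces *)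

Section representation.
Variables (R : realType) (C : convType R) (dist : C -> C -> R) (K : set C).
Variables (Y : pmSpace R) (T : C -> (Y -> R) -> R).
Implicit Types (x y z : C) (f : Y -> R) (a b : Y) (t : {i01 R}).
Local Notation d := (@pm_dist R Y).
Local Open Scope convex_scope.

(* [T] identifies [K] affinely with the states of [Y], and [dist] with the
   Kantorovich metric. *)
Record represents : Prop := Represents {
  rep_conv : forall t x y, K x -> K y -> K (x <| t |> y) ;
  rep_state : forall x, K x -> state (T x) ;
  rep_affine : forall t x y f, K x -> K y -> lip f ->
    T (x <| t |> y) f = t%:num * T x f + (1 - t%:num) * T y f ;
  rep_inj : forall x y, K x -> K y -> (forall f, lip f -> T x f = T y f) ->
    x = y ;
  rep_surj : forall m, state m ->
    exists2 x, K x & forall f, lip f -> T x f = m f ;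
  rep_dist : forall x y, K x -> K y -> dist x y =
    sup [set `|T x f - T y f| | f in [set f | lip_le 1 f]] }.

Hypotheses (rep : represents) (Ycpt : ultra_compact Y).

(** Additive constants make the test functions unbounded as a family; comparing both states with the
    Dirac state at [a] cancels them. *)
Lemma rep_dist_has_sup x y : K x -> K y ->
  has_sup [set `|T x f - T y f| | f in [set f : Y -> R | lip_le 1 f]].
Proof.
move=> Kx Ky; have sx := rep_state rep Kx; have sy := rep_state rep Ky.
have [a] := state_inhabited sx; split.
  by exists `|T x (d a) - T y (d a)|, (d a) => //; exact: lip_le_dist.
exists (T x (d a) + T y (d a)) => _ [f f1 <-].
rewrite (le_trans (ler_distD (f a) _ _))// (distrC (f a)).
have := state_at sx a ler01 f1; have := state_at sy a ler01 f1; lra.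
Qed.

Lemma rep_dist_ub x y f : K x -> K y -> lip_le 1 f ->
  `|T x f - T y f| <= dist x y.
Proof.
move=> Kx Ky f1; rewrite (rep_dist rep)//; apply: ub_le_sup; last by exists f.
by have [] := rep_dist_has_sup Kx Ky.
Qed.

Lemma rep_dist_le x y e : K x -> K y ->
  (forall f, lip_le 1 f -> `|T x f - T y f| <= e) -> dist x y <= e.
Proof.
move=> Kx Ky fe; rewrite (rep_dist rep)//; apply: ge_sup.
  by have [] := rep_dist_has_sup Kx Ky.
by move=> _ [f f1 <-]; exact: fe.
Qed.

Lemma rep_dist_lip L x y f : K x -> K y -> 0 <= L -> lip_le L f ->
  `|T x f - T y f| <= L * dist x y.
Proof.
move=> Kx Ky L0 fL; have sx := rep_state rep Kx; have sy := rep_state rep Ky.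
have [L00|L_gt0] := eqVneq L 0.
  have [a] := state_inhabited sx.
  have := state_at sx a L0 fL; have := state_at sy a L0 fL.
  rewrite L00 !mul0r !normr_le0 !subr_eq0 => /eqP -> /eqP ->.
  by rewrite eqxx.
have {}L_gt0 : 0 < L by rewrite lt_neqAle eq_sym L_gt0.
have f1 : lip_le 1 (fun a => L^-1 * f a).
  have := lip_leZ L^-1 fL.
  by rewrite gtr0_norm ?invr_gt0// mulVf// gt_eqF.
have := rep_dist_ub Kx Ky f1; have lf := lip_leW fL.
rewrite (stateZ sx)// (stateZ sy)// -mulrBr normrM gtr0_norm ?invr_gt0//.
by rewrite ler_pdivrMl.
Qed.

Lemma rep_dist_triangle x y z : K x -> K y -> K z ->
  dist x z <= dist x y + dist y z.
Proof.
move=> Kx Ky Kz; apply: rep_dist_le => // f f1.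
by rewrite (le_trans (ler_distD (T y f) _ _))// lerD// rep_dist_ub.
Qed.

Lemma rep_distC x y : K x -> K y -> dist x y = dist y x.
Proof.
move=> Kx Ky; rewrite !(rep_dist rep)//; congr sup; apply: eq_imagel => f _.
exact: distrC.
Qed.

Lemma rep_dist_eq0 x y : K x -> K y -> dist x y <= 0 -> x = y.
Proof.
move=> Kx Ky xy0; apply: (rep_inj rep) => // f [L L0 fL]; apply/eqP.
rewrite -subr_eq0 -normr_le0 (le_trans (rep_dist_lip Kx Ky L0 fL))//.
by rewrite mulr_ge0_le0.
Qed.

Definition represents_dirac x a := K x /\ forall f, lip f -> T x f = f a.

Lemma rep_dirac_ex a : exists x, represents_dirac x a.
Proof. by have [x Kx xa] := rep_surj rep (state_dirac a); exists x. Qed.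

Lemma rep_dirac_uniq x y a : represents_dirac x a -> represents_dirac y a ->
  x = y.
Proof.
by move=> [Kx xa] [Ky ya]; apply: (rep_inj rep) => // f lf; rewrite xa// ya.
Qed.

(** [d a] is the extremal test function: it vanishes at [a] and dominates the increment from [a] of
    every 1-Lipschitz function. *)
Lemma dist_dirac x y a : K x -> represents_dirac y a -> dist x y = T x (d a).
Proof.
move=> Kx [Ky ya]; apply: le_anti; have sx := rep_state rep Kx.
apply/andP; split.
  apply: rep_dist_le => // f f1; rewrite ya; last exact: lip_leW f1.
  by have := state_at sx a ler01 f1; rewrite mul1r.
apply: le_trans (rep_dist_ub Kx Ky (lip_le_dist a)).
by rewrite ya ?pmxx ?subr0 ?ler_norm//; exact: lip_dist.
Qed.

Lemma dist_dirac2 x y a b : represents_dirac x a -> represents_dirac y b ->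
  dist x y = d a b.
Proof.
move=> [Kx xa] yb; rewrite (dist_dirac Kx yb) xa 1?pmC//; exact: lip_dist.
Qed.

Lemma state_dist0_dirac x a : K x -> T x (d a) <= 0 -> represents_dirac x a.
Proof.
move=> Kx xa; split=> // f [L L0 fL]; apply/eqP; rewrite -subr_eq0 -normr_le0.
rewrite (le_trans (state_at (rep_state rep Kx) a L0 fL))//.
by rewrite mulr_ge0_le0.
Qed.

(** Condition on the bump [p] of [state_mass] and on [1 - p], with weight [T x p]. What matters is
    that [c] does not depend on [x]. *)
Lemma rep_split (e : R) : 0 < e -> exists2 c, 0 < c & forall x, K x ->
  exists x1 x2 a t, [/\ K x1, K x2, x = x1 <| t |> x2, c <= t%:num < 1 &
    T x1 (d a) <= e].
Proof.
move=> e0; have [c c0 cP] := state_mass Ycpt e0.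
exists c => // x Kx; have sx := rep_state rep Kx.
have [a [p [lp p01 pe cp]]] := cP _ sx.
have p0 b : 0 <= p b by case/andP: (p01 b).
have q0 b : 0 <= 1 - p b by case/andP: (p01 b); lra.
have lq : lip (fun b => 1 - p b) by apply: lipB => //; exact: lip_cst.
have tp : 0 < T x p by exact: lt_le_trans cp.
have p2 : T x p <= 2^-1.
  rewrite -[leRHS](state_cst sx); apply: (state_le sx) => //.
    exact: lip_cst.
  by move=> b; case/andP: (p01 b).
have tqE : T x (fun b => 1 - p b) = 1 - T x p.
  by rewrite (stateB sx)// ?state1//; exact: lip_cst.
have tq : 0 < T x (fun b => 1 - p b) by rewrite tqE; lra.
have [x1 Kx1 Tx1] := rep_surj rep (state_weight sx Ycpt lp p0 tp).
have [x2 Kx2 Tx2] := rep_surj rep (state_weight sx Ycpt lq q0 tq).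
have p1 : T x p <= 1 by lra.
exists x1, x2, a, (Itv01 (ltW tp) p1); split=> //=.
- apply: (rep_inj rep) => //; first exact: (rep_conv rep).
  move=> f lf; rewrite (rep_affine rep)//= Tx1// Tx2// -tqE.
  rewrite mulrCA divff ?gt_eqF// mulr1 mulrCA divff ?gt_eqF// mulr1.
  rewrite -(stateD sx); [|exact: lipM..].
  by congr (T x); apply/funext => b; ring.
- by apply/andP; split=> //; lra.
- rewrite Tx1; last exact: lip_dist.
  rewrite ler_pdivrMr// -(stateZ sx)//; apply: (state_le sx) => [||b].
  + by apply: lipM => //; exact: lip_dist.
  + exact: lipZ.
  + have [eab|abe] := leP e (d a b); first by rewrite pe// mul0r mulr0.
    by rewrite mulrC ler_wpM2r// ltW.
Qed.

(* With [S] the supremum of [Phi], splitting off a mass at least [c] gives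
   [S <= S - c (S - e)]. *)
Lemma rep_concentration (Phi : C -> R) (e e' B : R) : 0 < e' ->
  (forall x, K x -> Phi x <= B) ->
  (forall t x y, K x -> K y ->
    Phi (x <| t |> y) <= t%:num * Phi x + (1 - t%:num) * Phi y) ->
  (forall x a, K x -> T x (d a) <= e' -> Phi x <= e) ->
  forall x, K x -> Phi x <= e.
Proof.
move=> e'0 PB Pconv Pe x Kx.
have [c c0 cP] := rep_split e'0.
pose S := sup [set Phi z | z in K].
have hS : has_sup [set Phi z | z in K].
  by split; [exists (Phi x), x|exists B => _ [z Kz <-]; exact: PB].
have PS z : K z -> Phi z <= S.
  by move=> Kz; apply: ub_le_sup; [have [] := hS|exists z].
rewrite (le_trans (PS x Kx))// leNgt; apply/negP => eS.
have : S <= S - c * (S - e).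
  apply: ge_sup; first by have [] := hS.
  move=> _ [z Kz <-]; have [x1 [x2 [a [t [K1 K2 ->
    /andP[ct t1] T1]]]]] := cP z Kz.
  rewrite (le_trans (Pconv _ _ _ K1 K2))//.
  have := Pe _ _ K1 T1; have := PS _ K2; move: (t%:num) ct t1 => r cr r1.
  move: (Phi x1) (Phi x2) => u v vS ue.
  have : r * u <= r * e by rewrite ler_pM2l//; lra.
  have : (1 - r) * v <= (1 - r) * S by rewrite ler_pM2l//; lra.
  have : c * (S - e) <= r * (S - e) by rewrite ler_pM2r//; lra.
  by lra.
by apply/negP; rewrite -ltNge gtrDl oppr_lt0 mulr_gt0// subr_gt0.
Qed.

Definition extreme x := K x /\ forall t x1 x2, 0 < t%:num < 1 -> K x1 -> K x2 ->
  x = x1 <| t |> x2 -> x1 = x.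

(** [d a] is nonnegative and has value 0 at [x], so its value at the component [x1] of positive
    weight is 0 too. *)
Lemma dirac_extreme x a : represents_dirac x a -> extreme x.
Proof.
move=> xa; have [Kx xaE] := xa; split=> // t x1 x2 /andP[t0 t1] K1 K2 xE.
apply: (@rep_dirac_uniq _ _ a) => //; apply: state_dist0_dirac => //.
have lda := lip_dist a; have := xaE _ lda; rewrite pmxx xE (rep_affine rep)//.
have := state_ge0 (rep_state rep K2) lda (pm_ge0 a).
move: (t%:num) t0 t1 (T x1 _) (T x2 _) => r r0 r1 u v v0 uv.
rewrite leNgt; apply/negP => u0.
have : 0 < r * u by rewrite mulr_gt0.
have : 0 <= (1 - r) * v by rewrite mulr_ge0// subr_ge0 ltW.
lra.
Qed.

(** Extremality forces the concentrated component of [rep_split] to be [x] itself, at every scale;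
    the centers then accumulate at the required point. *)
Lemma extreme_dirac x : extreme x -> exists a, represents_dirac x a.
Proof.
move=> [Kx xext]; have sx := rep_state rep Kx.
have small n : exists a, T x (d a) <= n.+1%:R^-1.
  have n0 : 0 < n.+1%:R^-1 :> R by rewrite invr_gt0.
  have [c c0 /(_ x Kx)[x1 [x2 [a [t [K1 K2 xE /andP[ct t1] T1]]]]]] :=
    rep_split n0.
  exists a; rewrite -(xext t x1 x2)//.
  by rewrite t1 (lt_le_trans c0 ct).
have /choice[u uP] := small.
have [F [FU FN]] := ultra_nat.
have [a ua] := Ycpt u FU.
exists a; apply: state_dist0_dirac => //; apply/ler_addgt0Pr => e e0;
  rewrite add0r.
have e2 : 0 < e / 2 by rewrite divr_gt0.
have [N] := ltr_add_invr e2; rewrite add0r => Ne.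
have [n [/= una Nn]] := filter_ex (filterI (ua _ e2) (FN N)).
have : n.+1%:R^-1 <= N.+1%:R^-1 :> R by rewrite lef_pV2 ?posrE// ler_nat.
have := state_at sx (u n) ler01 (lip_le_dist a); rewrite pmC in una.
have := uP n; rewrite mul1r ler_norml.
move: (n.+1%:R^-1) (N.+1%:R^-1) Ne => r s se xr /andP[_ xa] rs; lra.
Qed.

Lemma affine_isometry_inj phi x y : affine_isometry_onto dist K phi ->
  K x -> K y -> phi x = phi y -> x = y.
Proof.
move=> [phiK phid _] Kx Ky xy; apply: rep_dist_eq0 => //.
have Kphiy : K (phi y) by rewrite -phiK; exists y.
by rewrite -phid// xy; apply: rep_dist_le => // f f1; rewrite subrr normr0.
Qed.

Lemma affine_isometry_extreme phi x : affine_isometry_onto dist K phi -> K x ->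
  extreme (phi x) <-> extreme x.
Proof.
move=> phiP Kx; have [phiK phid phia] := phiP.
have Kphi z : K z -> K (phi z) by move=> Kz; rewrite -phiK; exists z.
have Kphix := Kphi x Kx; split=> -[_ xext]; split=> //.
- move=> t x1 x2 t01 K1 K2 xE; apply: (affine_isometry_inj phiP) => //.
  by apply: (xext t _ (phi x2)); rewrite ?xE ?phia//; exact: Kphi.
- move=> t y1 y2 t01; rewrite -{1 2}phiK => -[x1 K1 <-] [x2 K2 <-].
  rewrite -phia// => /(affine_isometry_inj phiP Kx) xE; congr phi.
  by apply: (xext t _ x2) => //; apply: xE; exact: (rep_conv rep).
Qed.

Hypothesis Ydef : pm_definite Y.

(** [g] is read off from the images of Dirac states, which are again extreme. For the other states,
    the difference of the two sides is convex and bounded in [x], and small when [x] is concentrated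
    near a point, so [rep_concentration] makes it small everywhere. *)
Lemma affine_isometry_induced phi : affine_isometry_onto dist K phi ->
  exists2 g, isometry_onto g &
    forall x f, K x -> lip f -> T (phi x) f = T x (f \o g).
Proof.
move=> phiP; have [phiK phid phia] := phiP.
have Kphi z : K z -> K (phi z) by move=> Kz; rewrite -phiK; exists z.
have /choice[D DP] := rep_dirac_ex.
have KD a : K (D a) by have [] := DP a.
have gex a : exists b, represents_dirac (phi (D a)) b.
  apply: extreme_dirac; apply/affine_isometry_extreme => //.
  exact: dirac_extreme (DP a).
have /choice[g gP] := gex.
have gd a b : d (g a) (g b) = d a b.
  by rewrite -(dist_dirac2 (gP a) (gP b)) phid// (dist_dirac2 (DP a) (DP b)).
have hex b : exists a, g a = b.
  have := KD b; rewrite -{1}phiK => -[x Kx xb].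
  have /extreme_dirac[a xa] : extreme x.
    apply/(affine_isometry_extreme phiP Kx); rewrite xb.
    exact: dirac_extreme (DP b).
  exists a; apply: Ydef; rewrite -(dist_dirac2 (gP a) (DP b)).
  by rewrite (rep_dirac_uniq (DP a) xa) xb (dist_dirac2 (DP b) (DP b)) pmxx.
have /choice[h hP] := hex.
have ig : isometry_onto g.
  split=> //; exists h => // a; apply: Ydef; by rewrite -gd hP pmxx.
exists g => // x f Kx lf; have [L L0 fL] := lf.
have fg := lip_le_isometry ig fL; have lfg := lip_leW fg.
apply/eqP; rewrite -subr_eq0 -normr_le0; apply/ler_addgt0Pr => e e0;
  rewrite add0r.
have [B fB] := lip_bounded Ycpt lf.
(* Near the Dirac state of [a] each side differs from [f (g a)] by at most [L * T x (d a)], whence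
   the factor 2; the summand 1 avoids dividing by zero. *)
have L1 : 0 < 2 * (L + 1) by rewrite mulr_gt0// ltr_wpDl.
apply: (@rep_concentration (fun x => `|T (phi x) f - T x (f \o g)|) e
  (e / (2 * (L + 1))) (B + B)) => // {x Kx} [|x Kx|t x y Kx Ky|x a Kx xa].
- by rewrite divr_gt0.
- rewrite (le_trans (ler_normB _ _))// lerD//.
    exact: (state_bound (rep_state rep (Kphi _ Kx))).
  by apply: (state_bound (rep_state rep Kx)) => // a; exact: fB.
- rewrite phia// (rep_affine rep) ?(rep_affine rep)//; [|exact: Kphi..].
  set u := T (phi x) f; set v := T (phi y) f; set u' := T x _; set v' := T y _.
  have t0 : 0 <= t%:num by []. have t1 : 0 <= 1 - t%:num by rewrite subr_ge0.
  move: (t%:num) t0 t1 => r r0 r1.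
  rewrite -[X in X * `|_| + _]ger0_norm// -[X in _ + X * `|_|]ger0_norm//
    -!normrM.
  rewrite (le_trans _ (ler_normD _ _))// le_eqVlt; apply/orP; left; apply/eqP.
  by congr `|_|; ring.
- rewrite (le_trans (ler_distD (f (g a)) _ _))//.
  have := state_at (rep_state rep Kx) a L0 fg.
  have : `|T (phi x) f - T (phi (D a)) f| <= L * T x (d a).
    rewrite -(dist_dirac Kx (DP a)) -phid//.
    by apply: rep_dist_lip => //; exact: Kphi.
  rewrite (proj2 (gP a))// [in X in _ -> X]/= => u1 u2.
  rewrite distrC in u2; have := lerD u1 u2; move=> /le_trans; apply.
  rewrite -mulrDl -mulr2n -mulr_natl.
  apply: (@le_trans _ _ (2 * (L + 1) * T x (d a))).
    rewrite ler_wpM2r//; last by rewrite ler_pM2l// lerDl.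
    exact: (state_ge0 (rep_state rep Kx) (lip_dist a) (pm_ge0 a)).
  by rewrite mulrC -ler_pdivlMr.
Qed.

(** States are pushed forward along [g], and the inverse isometry gives surjectivity. [phi] is
    unconstrained off [K]. *)
Lemma isometry_induces g : isometry_onto g ->
  exists2 phi, affine_isometry_onto dist K phi &
    forall x f, K x -> lip f -> T (phi x) f = T x (f \o g).
Proof.
move=> ig.
have pex k x : isometry_onto k -> exists y, K x -> K y /\
    forall f, lip f -> T y f = T x (f \o k).
  move=> ik; have [Kx|nKx] := pselect (K x); last by exists x.
  have [y Ky yE] := rep_surj rep (state_isometry (rep_state rep Kx) ik).
  by exists y.
have /choice[phi phiP] := fun x => pex g x ig.
have Kphi x : K x -> K (phi x) by move=> /phiP[].
have phiE x f : K x -> lip f -> T (phi x) f = T x (f \o g).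
  by move=> /phiP[_]; apply.
exists phi => //; split.
- apply/seteqP; split=> [_ [x Kx <-]|y Ky]; first exact: Kphi.
  have [h [ih gK hK]] := isometry_inv ig.
  have [x /(_ Ky)[Kx xE]] := pex h y ih.
  exists x => //; apply: (rep_inj rep) => //; first exact: Kphi.
  move=> f lf; rewrite phiE// xE; last exact: lip_isometry.
  by congr (T y); apply/funext => a /=; rewrite hK.
- move=> x y Kx Ky; rewrite !(rep_dist rep)//; [|exact: Kphi..].
  congr sup; apply/seteqP; split=> _ [f f1 <-].
    exists (f \o g); first exact: lip_le_isometry.
    by rewrite !phiE//; exact: lip_leW f1.
  have [h [ih gK hK]] := isometry_inv ig.
  have fh1 : lip_le 1 (f \o h) by exact: lip_le_isometry.
  exists (f \o h) => //; rewrite !phiE//; try exact: lip_leW fh1.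
  by congr `|T x _ - T y _|; apply/funext => a /=; rewrite gK.
- move=> t x y Kx Ky; have Kxy := rep_conv rep t Kx Ky.
  apply: (rep_inj rep); [exact: Kphi| |move=> f lf].
    by apply: (rep_conv rep); exact: Kphi.
  rewrite phiE// (rep_affine rep)//; last exact: lip_isometry.
  by rewrite (rep_affine rep) ?phiE//; exact: Kphi.
Qed.

Lemma Fix_invariant x : Fix dist K x <-> K x /\ invariant_state (T x).
Proof.
split=> [[Kx xfix]|[Kx xinv]]; split=> //; first move=> f g lf ig.
  by have [phi phiP phiE] := isometry_induces ig; rewrite -phiE// xfix.
move=> phi phiP; have [g ig phiE] := affine_isometry_induced phiP.
have [phiK _ _] := phiP.
apply: (rep_inj rep) => //; first by rewrite -phiK; exists x.
by move=> f lf; rewrite phiE// xinv.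
Qed.

Lemma rep_ultra_compact (I : Type) (F : set_system I) (u : I -> C) :
  UltraFilter F -> (forall i, K (u i)) -> exists2 x, K x &
    forall e : R, 0 < e -> \forall i \near F, dist (u i) x <= e.
Proof.
move=> FU Ku; have su i : state (T (u i)) by exact: (rep_state rep).
have [m sm um] := state_ultra_limit su FU Ycpt.
have [x Kx xm] := rep_surj rep sm; exists x => // e e0.
apply: filterS (state_cvg_uniform su FU Ycpt sm um e0) => i ui.
by apply: rep_dist_le => // f f1; rewrite (xm f (lip_leW f1)); exact: ui.
Qed.

End representation.

(** * Orbit spaces: descent, compactness, separation *)

Section orbit_spaces.
Variables (R : realType) (Y : pmSpace R).
Implicit Types (f : Y -> R) (g : Y -> Y) (x y z : Y).
Local Notation d := (@pm_dist R Y).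
Local Notation Y1 := (orbit_pmSpace Y).

Lemma orbit_proj_isometry g x : isometry_onto g ->
  orbit_proj (g x) = orbit_proj x.
Proof.
move=> ig; apply: eq_exist; apply/seteqP; split=> _ [h ih <-].
  by exists (h \o g) => //; exact: isometry_comp.
have [k [ik gK kK]] := isometry_inv ig.
by exists (h \o k) => /=; [exact: isometry_comp|rewrite gK].
Qed.

Lemma orbit_proj_eq x y : orbit_proj x = orbit_proj y ->
  exists2 g, isometry_onto g & g y = x.
Proof.
move=> /(congr1 (@proj1_sig _ _)) /= xy.
have : iso_orbit x x by exists id => //; exact: isometry_id.
by rewrite xy => -[g ig gy]; exists g.
Qed.

Lemma lip_le_orbit_proj L (f : Y1 -> R) : 0 <= L -> lip_le L f ->
  lip_le L (fun x => f (orbit_proj x)).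
Proof.
move=> L0 fL x y; rewrite (le_trans (fL _ _))// ler_wpM2l//.
exact: orbit_dist_nonexpansive.
Qed.

Lemma lip_orbit_proj (f : Y1 -> R) : lip f -> lip (fun x => f (orbit_proj x)).
Proof. by move=> [L L0 fL]; exists L => //; exact: lip_le_orbit_proj. Qed.

(** Evaluation at a chosen representative; for invariant [f] the choice does not matter. *)
Definition orbit_descent f (A : Y1) : R := f (sval (cid (orbit_projP A))).

Lemma orbit_descentE f x : invariant_fun f ->
  orbit_descent f (orbit_proj x) = f x.
Proof.
move=> inf; rewrite /orbit_descent; case: cid => y /= xy.
by have [g ig <-] := orbit_proj_eq xy; rewrite inf.
Qed.

Lemma orbit_descent_proj (f : Y1 -> R) :
  orbit_descent (fun x => f (orbit_proj x)) = f.
Proof. by apply/funext => A; rewrite /orbit_descent; case: cid => x /= ->. Qed.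

(** Divided by [L], the differences of the descended function form a pseudometric for which the
    projection is nonexpansive; the greatest such pseudometric dominates it. *)
Lemma orbit_descent_lip_le L f : 0 <= L -> invariant_fun f -> lip_le L f ->
  lip_le L (orbit_descent f).
Proof.
move=> L0 inf fL; have [L00|L_gt0] := eqVneq L 0.
  move=> A B; have [x ->] := orbit_projP A; have [y ->] := orbit_projP B.
  by rewrite !orbit_descentE// (le_trans (fL _ _))// L00 !mul0r.
have {}L_gt0 : 0 < L by rewrite lt_neqAle eq_sym L_gt0.
have Li0 : 0 <= L^-1 by rewrite invr_ge0.
pose rho (A B : Y1) := L^-1 * `|orbit_descent f A - orbit_descent f B|.
have rhoP : pseudometric rho.
  split=> [A|A B|A B C]; rewrite /rho.
  - by rewrite subrr normr0 mulr0.
  - by rewrite distrC.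
  - by rewrite -mulrDr ler_wpM2l// ler_distD.
have rho1 : nonexpansive_proj rho.
  by move=> x y; rewrite /rho !orbit_descentE// ler_pdivrMl.
move=> A B; rewrite -ler_pdivrMl//; exact: (orbit_dist_greatest rhoP rho1 A B).
Qed.

Lemma orbit_descent_lip f : invariant_fun f -> lip f -> lip (orbit_descent f).
Proof. by move=> inf [L L0 fL]; exists L => //;
  exact: orbit_descent_lip_le. Qed.

Hypotheses (Ycpt : ultra_compact Y) (Ydef : pm_definite Y).

Lemma orbit_ultra_compact : ultra_compact Y1.
Proof.
move=> I F u FU; have /choice[v vP] := fun i => orbit_projP (u i).
have [y yP] := Ycpt v FU; exists (orbit_proj y) => e e0.
apply: filterS (yP e e0) => i; apply: le_lt_trans; rewrite vP.
exact: orbit_dist_nonexpansive.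
Qed.

(** The distance [h z] from [x] to the orbit of [z] is invariant and 1-Lipschitz, so it descends,
    and orbit distance 0 gives [h y = h x = 0]. An ultrafilter limit of isometries along a
    minimizing sequence attains the infimum. *)
Lemma orbit_definite : pm_definite Y1.
Proof.
move=> A B; have [x ->] := orbit_projP A; have [y ->] := orbit_projP B => xy0.
pose S z := [set d x (g z) | g in @isometry_onto R Y].
have S0 z : has_inf (S z).
  split; first by exists (d x z), id => //; exact: isometry_id.
  by exists 0 => _ [g _ <-]; exact: pm_ge0.
pose h z := inf (S z).
have hge z g : isometry_onto g -> h z <= d x (g z).
  by move=> ig; apply: ge_inf; [have [] := S0 z|exists g].
have inh : invariant_fun h.
  move=> g z ig; congr inf; apply/seteqP; split=> _ [k ik <-].
    by exists (k \o g) => //; exact: isometry_comp.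
  have [g' [ig' gK _]] := isometry_inv ig.
  by exists (k \o g') => /=; [exact: isometry_comp|rewrite gK].
have hle z w : h z <= h w + d z w.
  rewrite -lerBlDr; apply: lb_le_inf; first by have [] := S0 w.
  move=> _ [g ig <-]; rewrite lerBlDr (le_trans (hge z g ig))//.
  by rewrite (le_trans (pmD _ (g w) _))// lerD2l (proj1 ig) pmC.
have h1 : lip_le 1 h.
  move=> z w; rewrite mul1r ler_norml.
  have := hle z w; have := hle w z; rewrite (pmC w); lra.
have : `|h x - h y| <= 0.
  have := orbit_descent_lip_le ler01 inh h1 (orbit_proj x) (orbit_proj y).
  by rewrite !orbit_descentE// xy0 mulr0.
have -> : h x = 0.
  apply: le_anti; rewrite -{1}(pmxx x) (hge x id (isometry_id Y))/=.
  by apply: lb_le_inf; [have [] := S0 x|move=> _ [g _ <-]; exact: pm_ge0].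
rewrite sub0r normrN normr_le0 => /eqP hy.
have small n : exists g, isometry_onto g /\ d x (g y) < n.+1%:R^-1.
  have n0 : 0 < n.+1%:R^-1 :> R by rewrite invr_gt0.
  have [_ [g ig <-]] := inf_adherent n0 (S0 y).
  by rewrite -/(h y) hy add0r; exists g.
have /choice[u uP] := small.
have [F [FU FN]] := ultra_nat.
have iu n : isometry_onto (u n) by have [] := uP n.
have [g ig gP] := isometry_ultra_limit Ycpt Ydef FU iu.
suff -> : x = g y by rewrite orbit_proj_isometry.
apply: Ydef; apply: le_anti; rewrite pm_ge0 andbT.
apply/ler_addgt0Pr => e e0; rewrite add0r.
have e2 : 0 < e / 2 by rewrite divr_gt0.
have [N] := ltr_add_invr e2; rewrite add0r => Ne.
have [n [/= ung Nn]] := filter_ex (filterI (gP _ e2 y) (FN N)).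
have : n.+1%:R^-1 <= N.+1%:R^-1 :> R by rewrite lef_pV2 ?posrE// ler_nat.
have := pmD x (u n y) (g y); have [_] := uP n.
move: (n.+1%:R^-1) (N.+1%:R^-1) Ne => r s; lra.
Qed.

End orbit_spaces.

(** * Invariant states as states of the orbit space *)

Section Fix_representation.
Variables (R : realType) (C : convType R) (dist : C -> C -> R) (K : set C).
Variables (Y : pmSpace R) (T : C -> (Y -> R) -> R).
Hypotheses (rep : represents dist K T) (Ycpt : ultra_compact Y).
Hypothesis Ydef : pm_definite Y.
Local Open Scope convex_scope.

(** An invariant state cannot distinguish [f] from its average, which descends to the orbit space
    with the same Lipschitz constant ([desc]). This gives injectivity and the equality of the two
    suprema. *)
Theorem Fix_represents : represents dist (Fix dist K)
  (fun x (f : orbit_pmSpace Y -> R) => T x (fun y => f (orbit_proj y))).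
Proof.
have FixP := Fix_invariant rep Ycpt Ydef.
have [E [aE Einv Eiso]] := averaging_exists Ycpt Ydef.
have lipE f : lip f -> lip (fun y => E (f, y)).
  by move=> [L L0 fL]; exact: lip_leW (averaging_lip aE fL).
have TE x f : Fix dist K x -> lip f -> T x (fun y => E (f, y)) = T x f.
  move=> /FixP[Kx xinv] lf.
  exact: (averaging_invariant aE (rep_state rep Kx) xinv lf).
have desc x f : Fix dist K x -> lip f ->
    T x (fun y => orbit_descent (fun y => E (f, y)) (orbit_proj y)) = T x f.
  move=> Fx lf; rewrite -(TE x f)//; congr (T x); apply/funext => y.
  by rewrite orbit_descentE//; exact: Einv.
split.
- move=> t x y [Kx xfix] [Ky yfix]; split; first exact: (rep_conv rep).
  by move=> phi phiP; have [_ _ ->//] := phiP; rewrite xfix// yfix.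
- move=> x [Kx _]; have sx := rep_state rep Kx.
  split=> [f g lf lg|a f lf|f lf f0|].
  + by rewrite -(stateD sx)//; exact: lip_orbit_proj.
  + by rewrite -(stateZ sx)//; exact: lip_orbit_proj.
  + by apply: (state_ge0 sx) => //; exact: lip_orbit_proj.
  + exact: (state1 sx).
- move=> t x y f [Kx _] [Ky _] lf; rewrite (rep_affine rep)//.
  exact: lip_orbit_proj.
- move=> x y Fx Fy xy; have [Kx _] := Fx; have [Ky _] := Fy.
  apply: (rep_inj rep) => // f lf; rewrite -(desc x f)// -(desc y f)// xy//.
  by apply: orbit_descent_lip; [exact: Einv|exact: lipE].
- move=> m sm.
  (* [m] is extended to functions on [Y] by averaging first: [nu] is invariant because [E] ignores
     translations of [f], and gives back [m] because [E] fixes invariant functions. *)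
  pose nu f := m (orbit_descent (fun y => E (f, y))).
  have lE f : lip f -> lip (orbit_descent (fun y => E (f, y))).
    by move=> lf; apply: orbit_descent_lip; [exact: Einv|exact: lipE].
  have snu : state nu.
    split=> [f g lf lg|a f lf|f lf f0|]; rewrite /nu.
    + rewrite -(stateD sm); [|exact: lE..]; congr m; apply/funext => A.
      by rewrite /orbit_descent (stateD (averaging_state aE _)).
    + rewrite -(stateZ sm); last exact: lE.
      congr m; apply/funext => A.
      by rewrite /orbit_descent (stateZ (averaging_state aE _)).
    + apply: (state_ge0 sm) => [|A]; first exact: lE.
      exact: (state_ge0 (averaging_state aE _)).
    + rewrite -[RHS](state1 sm); congr m; apply/funext => A.
      exact: (state1 (averaging_state aE _)).
  have [x Kx xnu] := rep_surj rep snu; exists x => [|f lf].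
    apply/FixP; split=> // f g lf ig; rewrite !xnu//; last exact: lip_isometry.
    by rewrite /nu; congr m; apply/funext => A; rewrite /orbit_descent Eiso.
  have lfp := lip_orbit_proj lf.
  rewrite xnu// /nu -[RHS](congr1 m (orbit_descent_proj f)); congr m.
  apply/funext => A; rewrite /orbit_descent (averaging_fix aE)// => g y ig.
  by rewrite orbit_proj_isometry.
- move=> x y Fx Fy; have [Kx _] := Fx; have [Ky _] := Fy.
  rewrite (rep_dist rep)//; congr sup; apply/seteqP; split=> _ [f f1 <-].
    have lf := lip_leW f1.
    exists (orbit_descent (fun y => E (f, y))); last by rewrite !desc.
    apply: orbit_descent_lip_le => //; first exact: Einv.
    exact: (averaging_lip aE).
  by exists (fun y => f (orbit_proj y)) => //; exact: lip_le_orbit_proj.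
Qed.

End Fix_representation.

(** * From a state to a Borel probability measure *)

Section metric_pmSpace.
Variables (R : realType) (X : pointedMetricType R).
Local Notation Y := (PmSpace (mdist_pseudometric X)).

Lemma metric_ultra_compact : compact [set: X] -> ultra_compact Y.
Proof.
rewrite compact_ultra => Xcpt I F u FU.
have [|y [_ uy]] := Xcpt (u @ F) (ultra_fmap u FU); first exact: (@filterT _ F).
exists y => e e0; have : nbhs (y : X) (ball (y : X) e) by exact: nbhsx_ballx.
move=> /uy; rewrite ballEmdist => Fy; apply: (@filterS _ F) Fy => i /=.
by rewrite metric_sym.
Qed.

Lemma metric_definite : pm_definite Y.
Proof. by move=> x y /mdist_positivity. Qed.

Lemma lip_gt_open (f : Y -> R) a : lip f -> open [set x : X | a < f x].
Proof.
move=> [L L0 fL]; rewrite openE => x /= afx; rewrite /interior.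
have L1 : 0 < L + 1 by rewrite ltr_wpDl.
have e0 : 0 < (f x - a) / (L + 1) by rewrite divr_gt0// subr_gt0.
apply: filterS (nbhsx_ballx x _ e0); rewrite ballEmdist => y /= xy.
have := fL x y; have : L * mdist x y <= (L + 1) * mdist x y.
  by rewrite ler_wpM2r ?mdist_ge0// lerDl.
have : (L + 1) * mdist x y < f x - a by rewrite mulrC -ltr_pdivlMr.
by rewrite ler_norml /= => ? ? /andP[_]; lra.
Qed.

(** Truncated multiples of the distance to the complement increase to the indicator of an open
    set. *)
Lemma open_lip_approx (U : set X) : open U -> exists phi : nat -> Y -> R,
  [/\ forall n, lip (phi n), forall n x, 0 <= phi n x <= 1,
      forall n x, phi n x <= phi n.+1 x, forall n x, ~ U x -> phi n x = 0 &
      forall x, U x -> exists n, phi n x = 1].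
Proof.
(* With an empty complement the distance would be an infimum over the empty set; constants serve
   instead. *)
move=> oU; have [[w nUw]|Uall] := pselect (exists w, ~ U w); last first.
  exists (fun _ _ => 1); split=> // [n|n x|n x nUx|x Ux].
  - exact: lip_cst.
  - by rewrite ler01 lexx.
  - by case: Uall; exists x.
  - by exists 0%N.
pose S (x : X) := [set mdist x z | z in ~` U].
have S0 x : has_inf (S x).
  by split; [exists (mdist x w), w|exists 0 => _ [z _ <-]; exact: mdist_ge0].
pose dU x := inf (S x).
have dU0 x : 0 <= dU x.
  by apply: lb_le_inf; [have [] := S0 x|move=> _ [z _ <-]; exact: mdist_ge0].
have dUle x y : dU x <= dU y + mdist x y.
  rewrite -lerBlDr; apply: lb_le_inf; first by have [] := S0 y.
  move=> _ [z nUz <-]; rewrite lerBlDr addrC.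
  apply: le_trans (metric_triangle x y z).
  by apply: ge_inf; [have [] := S0 x|exists z].
have ldU : lip (dU : Y -> R).
  exists 1 => // x y; rewrite mul1r ler_norml /=.
  have := dUle x y; have := dUle y x; rewrite (metric_sym y x); lra.
exists (fun n x => Num.min 1 (n%:R * dU x)); split=> [n|n x|n x|n x nUx|x Ux].
- exact/lip_minr/lipZ.
- by rewrite le_min ler01 mulr_ge0//= ge_min lexx.
- by rewrite le_min !ge_min lexx/= ler_wpM2r ?ler_nat ?orbT.
- suff -> : dU x = 0 by rewrite mulr0; apply/min_idPr.
  apply: le_anti; rewrite dU0 andbT -(mdistxx x).
  by apply: ge_inf; [have [] := S0 x|exists x].
- have /nbhs_ballP[e /= e0] : nbhs (x : X) U by exact: open_nbhs_nbhs.
  rewrite ballEmdist => eU.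
  have edU : e <= dU x.
    apply: lb_le_inf; first by have [] := S0 x.
    by move=> _ [z nUz <-]; rewrite leNgt; apply/negP => /eU.
  exists (Num.trunc (e^-1)).+1; apply/min_idPl.
  have : e^-1 <= (Num.trunc e^-1).+1%:R by rewrite ltW// truncnS_gt.
  rewrite -(ler_pM2r e0) mulVf ?gt_eqF// => /le_trans; apply.
  by rewrite ler_wpM2l.
Qed.

Section outer_measure_of_state.
Variables (m : (Y -> R) -> R) (sm : state m).

(** Increasing sequences rather than single functions, in order to absorb countable unions. The
    infimum [state_content] of the bounds [c] is the Daniell upper integral of the indicator of
    [A]. *)
Definition lip_cover (A : set X) (c : R) := exists h : nat -> Y -> R,
  [/\ forall n, lip (h n), forall n x, 0 <= h n x,
      forall n k x, (n <= k)%N -> h n x <= h k x,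
      forall x, A x -> exists n, 1 <= h n x & forall n, m (h n) <= c].

Definition state_content (A : set X) : R := inf [set c | lip_cover A c].

Lemma lip_cover1 (f : Y -> R) A : lip f -> (forall x, 0 <= f x) ->
  (forall x, A x -> 1 <= f x) -> lip_cover A (m f).
Proof. by move=> lf f0 Af; exists (fun=> f); split=> // x /Af; exists 0%N. Qed.

Lemma lip_cover_ge0 A c : lip_cover A c -> 0 <= c.
Proof.
by move=> [h [lh h0 _ _ hc]]; apply: le_trans (hc 0%N); exact: (state_ge0 sm).
Qed.

Lemma lip_coverT A : lip_cover A 1.
Proof. by rewrite -(state1 sm); apply: lip_cover1 => //; exact: lip_cst. Qed.

Lemma lip_cover_has_inf A : has_inf [set c | lip_cover A c].
Proof.
by split; [exists 1; exact: lip_coverT|exists 0 => c; exact: lip_cover_ge0].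
Qed.

Lemma state_content_le A c : lip_cover A c -> state_content A <= c.
Proof. by move=> Ac; apply: ge_inf => //; have [] := lip_cover_has_inf A. Qed.

Lemma state_content_adherent A e : 0 < e ->
  exists2 c, lip_cover A c & c < state_content A + e.
Proof. by move=> e0; exact: inf_adherent (lip_cover_has_inf A). Qed.

Definition state_outer (A : set X) : \bar R := (state_content A)%:E.

Lemma state_outer0 : state_outer set0 = 0%E.
Proof.
congr EFin; apply: le_anti; apply/andP; split.
  rewrite -(state_cst sm 0); apply: state_content_le; apply: lip_cover1 => //.
  exact: lip_cst.
apply: lb_le_inf; first by have [] := lip_cover_has_inf set0.
by move=> c; exact: lip_cover_ge0.
Qed.

Lemma state_outer_ge0 A : (0 <= state_outer A)%E.
Proof.
rewrite lee_fin; apply: lb_le_inf; first by have [] := lip_cover_has_inf A.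
by move=> c; exact: lip_cover_ge0.
Qed.

Lemma state_outer_le : {homo state_outer : A B / A `<=` B >-> (A <= B)%E}.
Proof.
move=> A B AB; rewrite lee_fin; apply: lb_le_inf.
  by have [] := lip_cover_has_inf B.
move=> c [h [lh h0 hn Bh hc]]; apply: state_content_le.
by exists h; split=> // x /AB /Bh.
Qed.

Lemma state_outer_sigma_subadditive : sigma_subadditive state_outer.
Proof.
move=> A; apply/lee_addgt0Pr => e e0.
have ex i : exists h : nat -> Y -> R, [/\ forall n, lip (h n),
    forall n x, 0 <= h n x, forall n k x, (n <= k)%N -> h n x <= h k x,
    forall x, A i x -> exists n, 1 <= h n x &
    forall n, m (h n) <= state_content (A i) + e / (2 ^ i.+1)%:R].
  have ei : 0 < e / (2 ^ i.+1)%:R by rewrite divr_gt0// ltr0n expn_gt0.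
  have [c [h [lh h0 hn Ah hc]] cA] := state_content_adherent (A i) ei.
  by exists h; split=> // n; rewrite (le_trans (hc n))// ltW.
have /choice[h hP] := ex.
have lh i n : lip (h i n) by have [] := hP i.
have h0 i n x : 0 <= h i n x by have [_ + _ _ _] := hP i; exact.
have hn i n k x : (n <= k)%N -> h i n x <= h i k x.
  by have [_ _ + _ _] := hP i; exact.
apply: le_trans (epsilon_trick xpredT (fun i => state_outer_ge0 (A i)) (ltW
  e0)).
have eA n : (0 <= state_outer (A n) + (e / (2 ^ n.+1)%:R)%:E)%E.
  by rewrite adde_ge0 ?state_outer_ge0// lee_fin divr_ge0// ltW.
have sumE n : ((m (fun x => \sum_(i < n.+1) h i n x)%R)%:E <=
    \sum_(i <oo) (state_outer (A i) + (e / (2 ^ i.+1)%:R)%:E))%E.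
  apply: le_trans (nneseries_lim_ge n.+1 _) => //; rewrite big_mkord.
  rewrite (state_sum sm)// -sumEFin; apply: lee_sum => i _;
    rewrite -EFinD lee_fin.
  by have [_ _ _ _] := hP i.
have [Sfin|] := boolP (\sum_(i <oo) (state_outer (A i) +
    (e / (2 ^ i.+1)%:R)%:E) \is a fin_num)%E; last first.
  rewrite ge0_fin_numE; last exact: nneseries_ge0.
  by rewrite -leNgt leye_eq => /eqP ->; rewrite leey.
rewrite -(fineK Sfin) lee_fin; apply: state_content_le.
(* Diagonal sequence: stage [n] takes the first [n + 1] covers at their [n]-th terms, so it
   increases both in the number of terms and in each term. *)
exists (fun n x => \sum_(i < n.+1) h i n x);
  split=> [n|n x|n k x nk|x [i _ Aix]|n].
- exact: lip_sum.
- exact: sumr_ge0.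
- rewrite -(big_mkord xpredT (fun i => h i n x)) -(big_mkord xpredT (fun i => h
  i k x)).
  rewrite [leRHS](big_cat_nat (n := n.+1))//= ler_wpDr ?sumr_ge0//.
  by apply: ler_sum => i _; exact: hn.
- have [_ _ _ /(_ x Aix)[n hin] _] := hP i.
  exists (maxn i n); have im : (i < (maxn i n).+1)%N by rewrite ltnS leq_maxl.
  rewrite (bigD1 (Ordinal im))//= (le_trans hin)// (le_trans (hn i n (maxn i n)
    x _))//.
    exact: leq_maxr.
  by rewrite lerDl sumr_ge0.
- by rewrite -lee_fin fineK.
Qed.

HB.instance Definition _ := isOuterMeasure.Build R X state_outer
  state_outer0 state_outer_ge0 state_outer_le state_outer_sigma_subadditive.

Hypothesis Ycpt : ultra_compact Y.

(* A cover [h] of [A] splits into the cover [h * phi] of [A `&` U] and the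
   cover [h * (1 - phi k)] of [A `\` U], for [k] large. *)
Lemma open_caratheodory U : open U -> state_outer.-caratheodory U.
Proof.
move=> oU; apply: le_caratheodory_measurable => A.
rewrite -EFinD lee_fin; apply: lb_le_inf;
  first by have [] := lip_cover_has_inf A.
move=> c [h [lh h0 hn Ah hc]].
have [phi [lphi phi01 phi_le phiC phiU]] := open_lip_approx oU.
have phi0 n x : 0 <= phi n x by case/andP: (phi01 n x).
have phi1 n x : phi n x <= 1 by case/andP: (phi01 n x).
have phin n k x : (n <= k)%N -> phi n x <= phi k x.
  move=> nk; rewrite -(subnKC nk); elim: (k - n)%N => [|j ih];
    first by rewrite addn0.
  by rewrite addnS (le_trans ih).
pose s n := m (fun x => h n x * phi n x).
have lhphi n k : lip (fun x => h n x * phi k x) by exact: lipM.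
have hphi n k x : (n <= k)%N -> h n x * phi n x <= h k x * phi k x.
  by move=> nk; rewrite ler_pM ?hn ?phin.
have sc n : s n <= c.
  apply: le_trans (hc n); apply: (state_le sm) => // x.
  by rewrite ler_piMr.
pose S := range s.
have hS : has_sup S by split; [exists (s 0%N), 0%N|exists c => _ [n _ <-]].
have sS n : s n <= sup S by apply: ub_le_sup; [have [] := hS|exists n].
have cU : lip_cover (A `&` U) (sup S).
  exists (fun n x => h n x * phi n x); split=> // [n x|x [Ax Ux]].
    exact: mulr_ge0.
  have [i hi] := Ah x Ax; have [j phij] := phiU x Ux; exists (maxn i j).
  rewrite -[leLHS]mulr1 ler_pM//.
    by rewrite (le_trans hi)// hn// leq_maxl.
  by rewrite -phij phin// leq_maxr.
apply/ler_addgt0Pr => e e0.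
have [_ [k _ <-] sk] := sup_adherent e0 hS.
have lq : lip (fun x => 1 - phi k x) by apply: lipB => //; exact: lip_cst.
have cV : lip_cover (A `&` ~` U) (c - sup S + e).
  (* The shift by [k] makes every [h (n + k)] dominate [h k], so the part removed by [phi k] has
     value at least [s k], which exceeds [sup S - e]. *)
  exists (fun n x => h (n + k)%N x * (1 - phi k x)).
  split=> [n|n x|n j x nj|x [Ax nUx]|n].
  - exact: lipM.
  - by rewrite mulr_ge0// subr_ge0.
  - by rewrite ler_wpM2r ?subr_ge0// hn// leq_add2r.
  - have [i hi] := Ah x Ax; exists i; rewrite phiC// subr0 mulr1.
    by rewrite (le_trans hi)// hn// leq_addr.
  - rewrite (_ : (fun x => _) = (fun x => h (n + k)%N x - h (n + k)%N x * phi k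
    x)).
      rewrite (stateB sm)//; have := hc (n + k)%N.
      have : s k <= m (fun x => h (n + k)%N x * phi k x).
        by apply: (state_le sm) => // x; rewrite ler_wpM2r// hn// leq_addl.
      lra.
    by apply/funext => x; rewrite mulrBr mulr1.
have := state_content_le cU; have := state_content_le cV; lra.
Qed.

(** Dini's argument: points where [h n] stays below [1 - e] would accumulate at some [x], where a
    fixed [h N] already reaches 1. So a cover of the whole space exceeds [1 - e] uniformly at some
    stage. *)
Lemma state_contentT : state_content [set: X] = 1.
Proof.
apply: le_anti; rewrite (state_content_le (lip_coverT _))/=.
apply: lb_le_inf; first by have [] := lip_cover_has_inf setT.
move=> c [h [lh h0 hn hT hc]]; apply/ler_addgt0Pr => e e0; rewrite -lerBlDr.
suff [n hen] : exists n, forall x, 1 - e <= h n x.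
  apply: le_trans (hc n); rewrite -[leLHS](state_cst sm).
  by apply: (state_le sm) => //; exact: lip_cst.
apply: contrapT => /forallNP nex.
have /choice[u uP] : forall n, exists x, h n x < 1 - e.
  by move=> n; have /existsNP[x /negP] := nex n; rewrite -ltNge; exists x.
have [F [FU FN]] := ultra_nat.
have [x ux] := Ycpt u FU.
have [N hN] := hT x I; have [L L0 hL] := lh N.
have L1 : 0 < L + 1 by rewrite ltr_wpDl.
have [n [/= un Nn]] := filter_ex (filterI (ux _ (divr_gt0 e0 L1)) (FN N)).
move: un; rewrite /= ltr_pdivlMr// => un.
have := hL (u n) x; rewrite ler_norml => /andP[+ _].
have := hn N n (u n) Nn; have := uP n; have := mdist_ge0 (u n) x.
move: hN un; rewrite /=; lra.
Qed.

(** The outer measure is cut to 0 off the Borel sets, as membership in [Prob] requires. *)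
Definition state_measure (A : set (borel X)) : \bar R :=
  if `[< measurable A >] then state_outer A else 0%E.

Lemma borel_caratheodory (A : set (borel X)) :
  measurable A -> state_outer.-caratheodory A.
Proof.
have sa := @sigma_algebra_measurable _ (caratheodory_type state_outer).
by apply: (smallest_sub sa) => U; exact: open_caratheodory.
Qed.

Let state_measure0 : state_measure set0 = 0%E.
Proof. by rewrite /state_measure; case: asboolP => // _;
  exact: state_outer0. Qed.

Let state_measure_ge0 A : (0 <= state_measure A)%E.
Proof. by rewrite /state_measure; case: asboolP => // _;
  exact: state_outer_ge0. Qed.

Let state_measure_sigma_additive : semi_sigma_additive state_measure.
Proof.
move=> A mA tA mUA.
rewrite [X in X @ _](_ : _ = fun n => (\sum_(0 <= i < n) state_outer (A i))%E);
    last first.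
  by apply/funext => n; apply: eq_bigr => i _; rewrite /state_measure asboolT.
rewrite /state_measure asboolT//.
have := @caratheodory_measure_sigma_additive R X state_outer A.
have mcA i : state_outer.-cara.-measurable (A i) by exact: borel_caratheodory.
have mcUA : state_outer.-cara.-measurable (\bigcup_i A i) by exact:
  borel_caratheodory.
exact.
Qed.

HB.instance Definition _ := isMeasure.Build _ _ _ state_measure
  state_measure0 state_measure_ge0 state_measure_sigma_additive.

Let state_measureT : state_measure setT = 1%E.
Proof. by rewrite /state_measure asboolT// /state_outer state_contentT. Qed.

HB.instance Definition _ :=
  Measure_isProbability.Build _ _ _ state_measure state_measureT.

Definition state_probability : probability (borel X) R := state_measure.

End outer_measure_of_state.
End metric_pmSpace.

(** * Comparing two states by layers *)

Section states_comparison.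
Variables (R : realType) (Y : pmSpace R).

Definition unit_clamp (r : R) := Num.max 0 (Num.min 1 r).

Lemma sum_unit_clamp (r : R) n : 0 <= r ->
  \sum_(i < n) unit_clamp (r - i%:R) = Num.min r n%:R.
Proof.
move=> r0; elim: n => [|n ih].
  by rewrite big_ord0; apply/esym/min_idPr.
rewrite big_ord_recr/= ih /unit_clamp -natr1.
have [rn|rn] := leP r n%:R; have [r1|r1] := leP 1 (r - n%:R);
  have [r2|r2] := leP r (n%:R + 1); rewrite /Num.max; do ?case: ifP;
  rewrite ?addr0 ?ltr01//; lra.
Qed.

Variables I m : (Y -> R) -> R.
Hypotheses (sI : state I) (sm : state m) (Ycpt : ultra_compact Y).
Hypothesis Im : forall c c' : Y -> R, lip c -> lip c' ->
  (forall x, 0 <= c x <= 1) -> (forall x, 0 <= c' x) ->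
  (forall x, 0 < c x -> 1 <= c' x) -> I c <= m c'.

(* [n * f] is the sum of the layers [c i := unit_clamp (n * f - i)], and
   [c i] equals [1] wherever [c i.+1] is positive. *)
Lemma state_le_layers f : lip f -> (forall x, 0 <= f x <= 1) -> I f <= m f.
Proof.
move=> lf f01; apply/ler_addgt0Pr => e e0.
have [n] := ltr_add_invr e0; rewrite add0r => ne.
pose c i x := unit_clamp (n.+1%:R * f x - i%:R).
have lc i : lip (c i).
  by apply/lip_maxr/lip_minr/lipB; [exact: lipZ|exact: lip_cst].
have c01 i x : 0 <= c i x <= 1.
  by rewrite /c /unit_clamp le_max lexx/= ge_max ler01 ge_min lexx.
have cE J : state J -> n.+1%:R * J f = \sum_(i < n.+1) J (c i).
  move=> sJ; rewrite -(stateZ sJ)// -(state_sum sJ)//; congr J.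
  apply/funext => x; have /andP[f0 f1] := f01 x.
  rewrite sum_unit_clamp ?mulr_ge0//; apply/esym/min_idPl.
  by rewrite ler_piMr.
have n0 : 0 < n.+1%:R :> R by [].
(* The layers of [I] are compared with those of [m] one index lower. The unmatched [I (c 0)] is at
   most 1, which [n.+1%:R * e] absorbs; the unmatched [m (c n)] is nonnegative. *)
rewrite -(ler_pM2l n0) mulrDr (cE _ sI) (cE _ sm) [leLHS]big_ord_recl/=.
rewrite [X in _ <= X + _]big_ord_recr/=.
have : I (c 0%N) <= 1.
  rewrite -[leRHS](state_cst sI); apply: (state_le sI) => // [|x].
    exact: lip_cst.
  by case/andP: (c01 0%N x).
have : 0 <= m (c n).
  by apply: (state_ge0 sm) => // x; case/andP: (c01 n x).
have : 1 <= n.+1%:R * e by rewrite -ler_pdivrMl// mulr1 ltW.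
have : \sum_(i < n) I (c (bump 0 i)) <= \sum_(i < n) m (c i).
  apply: ler_sum => i _; apply: Im => // [x|x]; first by case/andP: (c01 i x).
  rewrite /c /unit_clamp lt_max ltxx/= lt_min ltr01/= /bump/= natrD => ci.
  rewrite le_max le_min lexx/=; apply/orP; right; lra.
lra.
Qed.

(** Applying the inequality to [1 - g] reverses it; a bounded [f] is brought into the unit interval
    by an affine change. *)
Lemma state_eq_layers f : lip f -> I f = m f.
Proof.
have eq01 g : lip g -> (forall x, 0 <= g x <= 1) -> I g = m g.
  move=> lg g01; apply: le_anti; rewrite state_le_layers//=.
  have lg' : lip (fun x => 1 - g x) by apply: lipB => //; exact: lip_cst.
  have := state_le_layers lg'; rewrite (stateB sI)//; last exact: lip_cst.
  rewrite (stateB sm)//; last exact: lip_cst.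
  rewrite !state_cst// lerD2l lerN2; apply=> x.
  by have /andP[g0 g1] := g01 x; rewrite subr_ge0 g1/= gerBl.
move=> lf; have [B fB] := lip_bounded Ycpt lf.
have [y] := state_inhabited sI.
have B0 : 0 <= B by exact: le_trans (normr_ge0 _) (fB y).
have B1 : 0 < 2 * (B + 1) by rewrite mulr_gt0// ltr_wpDl.
pose g x := (2 * (B + 1))^-1 * (f x + (B + 1)).
have lg : lip g by apply/lipZ/lipD => //; exact: lip_cst.
have g01 x : 0 <= g x <= 1.
  have := fB x; rewrite ler_norml => /andP[f0 f1].
  rewrite /g mulr_ge0 ?invr_ge0 ?(ltW B1)//=; last by lra.
  by rewrite ler_pdivrMl// mulr1; lra.
have fE : f = (fun x => (2 * (B + 1)) * g x - (B + 1)).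
  apply/funext => x; rewrite /g mulrA divff ?gt_eqF// mul1r; lra.
rewrite fE (stateB sI); [|exact: lipZ|exact: lip_cst].
rewrite (stateB sm); [|exact: lipZ|exact: lip_cst].
by rewrite (stateZ sI)// (stateZ sm)// eq01// !state_cst.
Qed.

End states_comparison.

Lemma ge0_integral_mixture d (T : measurableType d) (R : realType)
    (mu nu : probability T R) (t : {i01 R}) (f : T -> \bar R) :
  (forall x, 0 <= f x)%E -> measurable_fun [set: T] f ->
  (\int[pmixture t mu nu]_x f x =
   t%:num%:E * \int[mu]_x f x + (1 - t%:num)%R%:E * \int[nu]_x f x)%E.
Proof.
move=> f0 mf; have t0 : 0 <= t%:num by [].
have t10 : 0 <= 1 - t%:num by rewrite subr_ge0.
rewrite (eq_measure_integral
  (measure_add (mscale (NngNum t0) mu) (mscale (NngNum t10) nu))); last first.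
  move=> A mA _; apply/esym.
  exact: (measure_addE (mscale (NngNum t0) mu) (mscale (NngNum t10) nu)).
by rewrite ge0_integral_measure_add// !ge0_integral_mscale.
Qed.

(** * Borel probability measures as the states of [X] *)

Section Prob_representation.
Variables (R : realType) (X : pointedMetricType R).
Hypothesis compactX : compact [set: X].
Local Open Scope convex_scope.
Local Notation Y := (PmSpace (mdist_pseudometric X)).
Implicit Types (f : Y -> R) (mu nu : probability (borel X) R).

Let Ycpt : ultra_compact Y := metric_ultra_compact compactX.

Definition prob_integral mu f : R := \int[mu]_(x in [set: borel X]) f x.

Lemma measurable_lip f : lip f -> measurable_fun [set: borel X] (f : borel X ->
  R).
Proof.
move=> lf; apply: (measurability _ (RGenOInfty.measurableE R)) => //.
move=> /= _ [_ [a ->] <-]; rewrite setTI; apply: sub_sigma_algebra.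
have := lip_gt_open a lf; congr open; apply/seteqP; split=> x /=;
  by rewrite in_itv/= andbT.
Qed.

Lemma integrable_lip mu f : lip f ->
  mu.-integrable [set: borel X] (EFin \o (f : borel X -> R)).
Proof.
move=> lf; apply: measurable_bounded_integrable => //.
- by rewrite [ltLHS](@probability_setT _ _ _ mu) ltry.
- exact: measurable_lip.
- have [B fB] := lip_bounded Ycpt lf.
  exists B; split; first exact: num_real.
  by move=> x Bx y _; exact: le_trans (fB y) (ltW Bx).
Qed.

Lemma prob_integral_state mu : state (prob_integral mu).
Proof.
split=> [f g lf lg|a f lf|f lf f0|].
- by rewrite /prob_integral RintegralD//; exact: integrable_lip.
- by rewrite /prob_integral RintegralZl//; exact: integrable_lip.
- exact: Rintegral_ge0.
- by rewrite /prob_integral Rintegral_cst// [X in fine X](@probability_setT _ _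
  _ mu) mulr1.
Qed.

Lemma prob_integralE mu f : lip f ->
  (prob_integral mu f)%:E = (\int[mu]_(x in [set: borel X]) (f x)%:E)%E.
Proof.
by move=> lf; rewrite fineK//; apply: integrable_fin_num => //;
  exact: integrable_lip.
Qed.

Lemma prob_integral_le_support mu f : lip f -> (forall x, 0 <= f x <= 1) ->
  ((prob_integral mu f)%:E <= mu [set x | 0 < f x]%R)%E.
Proof.
move=> lf f01; have mf := measurable_lip lf.
have mA : measurable [set x : borel X | 0 < f x].
  exact: sub_sigma_algebra (lip_gt_open 0 lf).
have := integral_indic mu measurableT mA; rewrite setIT => <-.
rewrite prob_integralE//.
apply: ge0_le_integral => //.
- by move=> x _; rewrite lee_fin; case/andP: (f01 x).
- exact/measurable_EFinP.
- exact/measurable_EFinP/measurable_indic.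
- move=> x _; rewrite lee_fin indicE; have /andP[f0 f1] := f01 x.
  by case: (boolP (x \in _)) => //; rewrite notin_setE/= => /negP;
    rewrite -leNgt.
Qed.

Lemma measurable_lip_ge1 f : lip f -> measurable [set x : borel X | 1 <= f x].
Proof.
move=> lf; rewrite (_ : [set x | _] = ~` [set x : borel X | - 1 < - f x]).
  apply: measurableC; apply: sub_sigma_algebra.
  exact: (lip_gt_open (-1) (lipN lf)).
by apply/seteqP; split=> x /=; rewrite ltrN2 leNgt => /negP.
Qed.

Lemma prob_le_integral mu f : lip f -> (forall x, 0 <= f x) ->
  (mu [set x | 1 <= f x]%R <= (prob_integral mu f)%:E)%E.
Proof.
move=> lf f0; have mf := measurable_lip lf.
have mA := measurable_lip_ge1 lf.
have := integral_indic mu measurableT mA; rewrite setIT => <-.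
rewrite prob_integralE//.
apply: ge0_le_integral => //.
- exact/measurable_EFinP/measurable_indic.
- exact/measurable_EFinP.
- move=> x _; rewrite lee_fin indicE.
  by case: (boolP (x \in _)) => //; rewrite inE.
Qed.

(** The sets [V n] where [phi n] reaches 1 increase to [U], and the integral of [phi n] separates
    [mu (V n)] from [nu U]: it is above the former for [mu] and below the latter for [nu]. *)
Lemma prob_open_le mu nu U :
  (forall f, lip f -> prob_integral mu f = prob_integral nu f) ->
  open (U : set X) -> (mu U <= nu U)%E.
Proof.
move=> munu oU; have [phi [lphi phi01 phi_le phiC phiU]] := open_lip_approx oU.
have phi0 n x : 0 <= phi n x by case/andP: (phi01 n x).
have mU : measurable (U : set (borel X)) by exact: sub_sigma_algebra.
pose V n := [set x : borel X | 1 <= phi n x].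
have mV n : measurable (V n) by exact: measurable_lip_ge1.
have UV : \bigcup_n V n = U.
  apply/seteqP; split=> [x [n _ /= Vn]|x /phiU[n phin]]; last first.
    by exists n => //; rewrite /V/= phin.
  by apply: contrapT => nUx; move: Vn; rewrite /V/= phiC// ler10.
have Vn : nondecreasing_seq V.
  apply/nondecreasing_seqP => n; apply/subsetPset => x /= Vx.
  exact: le_trans (phi_le n x).
have mUV : measurable (\bigcup_n V n) by rewrite UV.
have muV := nondecreasing_cvg_mu (mu := mu) mV mUV Vn; rewrite UV in muV.
rewrite -(cvg_lim _ muV)//; apply: lime_le; first by apply/cvg_ex; eexists;
  exact: muV.
apply: nearW => n; apply: le_trans (prob_le_integral mu (lphi n) (phi0 n)) _.
rewrite munu//; apply: le_trans (prob_integral_le_support nu (lphi n) (phi01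
  n)) _.
apply: le_measure; rewrite ?inE//.
  exact: sub_sigma_algebra (lip_gt_open 0 (lphi n)).
by move=> x /= phix; apply: contrapT => /(phiC n) nphi;
  rewrite nphi ltxx in phix.
Qed.

Lemma prob_integral_inj mu nu : Prob X mu -> Prob X nu ->
  (forall f, lip f -> prob_integral mu f = prob_integral nu f) -> mu = nu.
Proof.
move=> Pmu Pnu munu; apply: probability_eq; apply/funext => A.
have [mA|nmA] := pselect (measurable A); last by rewrite Pmu// Pnu.
apply: (@measure_unique _ R (borel X) (@open X) (fun=> setT)) => //.
- by move=> U V; exact: openI.
- by move=> _; exact: openT.
- by rewrite bigcup_const.
- move=> U oU; apply: le_anti; rewrite !prob_open_le// => f lf.
  by rewrite munu.
- by move=> _; rewrite [ltLHS](@probability_setT _ _ _ mu) ltry.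
Qed.

Lemma prob_integral_affine (t : {i01 R}) mu nu f : lip f ->
  prob_integral (mu <| t |> nu) f =
  t%:num * prob_integral mu f + (1 - t%:num) * prob_integral nu f.
Proof.
have pos g : lip g -> (forall x, 0 <= g x) ->
    prob_integral (mu <| t |> nu) g =
    t%:num * prob_integral mu g + (1 - t%:num) * prob_integral nu g.
  move=> lg g0; apply: EFin_inj; rewrite EFinD !EFinM !prob_integralE//.
  have mg := measurable_lip lg.
  apply: ge0_integral_mixture; first by move=> x; rewrite lee_fin.
  exact/measurable_EFinP.
(* The formula for nonnegative functions is applied to [f + B], and the constant [B] cancels. *)
move=> lf; have [B fB] := lip_bounded Ycpt lf.
have lfB : lip (fun x => f x + B) by apply: lipD => //; exact: lip_cst.
have := pos _ lfB; rewrite !(stateD (prob_integral_state _))//;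
  try exact: lip_cst.
rewrite !(state_cst (prob_integral_state _)) => posB.
have /posB : forall x, 0 <= f x + B.
  by move=> x; have := fB x; rewrite ler_norml => /andP[]; lra.
move: (prob_integral _ f) (prob_integral mu f) (prob_integral nu f) => u v w;
  lra.
Qed.

Theorem Prob_represents : represents (@kantorovich R X) (Prob X) prob_integral.
Proof.
split=> [t mu nu Pmu Pnu A nmA|mu _|t mu nu f _ _|mu nu Pmu Pnu|m sm|mu nu _ _].
- by rewrite /conv/= /mixture Pmu// Pnu// !mule0 adde0.
- exact: prob_integral_state.
- exact: prob_integral_affine.
- exact: prob_integral_inj.
- exists (state_probability sm Ycpt).
    by move=> A nmA; rewrite /= /state_measure asboolF.
  (* The measure of the set where [c] is positive lies between the two sides: it bounds the integral
     of [c] from above, and [c'] is a constant cover of that set. *)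
  apply: state_eq_layers => //; first exact: prob_integral_state.
  move=> c c' lc lc' c01 c'0 cc'; rewrite -lee_fin.
  apply: le_trans (prob_integral_le_support _ lc c01) _.
  rewrite /= /state_measure asboolT; last first.
    exact: sub_sigma_algebra (lip_gt_open 0 lc).
  by rewrite lee_fin; apply: state_content_le => //; exact: lip_cover1.
- congr sup; apply/seteqP; split=> _ [f f1 <-]; exists f => // x y.
    by rewrite mul1r; exact: f1.
  by have := f1 x y; rewrite mul1r.
Qed.

End Prob_representation.

(** * Iterating [Fix] and passing to the limit *)

Section iterated_fixed_points.
Variables (R : realType) (X : pointedMetricType R).
Hypothesis compactX : compact [set: X].
Local Notation dist := (@kantorovich R X).
Local Notation K n := (iter n (Fix dist) (Prob X)).

(** Compactness and separation of [iter_orbit X n] belong to the induction because each application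
    of [Fix_represents] uses them for the current space. *)
Lemma iter_Fix_represents n : exists T : _ -> (iter_orbit X n -> R) -> R,
  [/\ represents dist (K n) T, ultra_compact (iter_orbit X n) &
      pm_definite (iter_orbit X n)].
Proof.
elim: n => [|n [T [rT Ycpt Ydef]]].
  exists (@prob_integral R X); split; first exact: Prob_represents.
    exact: metric_ultra_compact.
  exact: metric_definite.
exists (fun x f => T x (fun y => f (orbit_proj y))); split.
- exact: Fix_represents.
- exact: orbit_ultra_compact.
- exact: orbit_definite.
Qed.

Lemma iter_orbit_inhabited n : inhabited (iter_orbit X n).
Proof.
elim: n => [|n [y]]; first by exists; exact: (point : X).
by exists; exact: (orbit_proj y).
Qed.

Lemma iter_Fix_decreasing n k : (n <= k)%N -> K k `<=` K n.
Proof.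
move=> nk; rewrite -(subnKC nk); elim: (k - n)%N => [|j ih];
  first by rewrite addn0.
by rewrite addnS iterS => x [/ih].
Qed.

(** Compactness gives a limit inside each [K N]; these limits coincide because [dist] separates the
    points of [K 0], so the common limit lies in all of them. *)
Lemma iter_Fix_limit (F : set_system nat) (u : nat -> probability (borel X) R) :
  UltraFilter F -> (forall N, F [set n | (N <= n)%N]) ->
    (forall n, K n (u n)) ->
  exists2 x, Delta X x &
    forall e : R, 0 < e -> \forall n \near F, dist (u n) x <= e.
Proof.
move=> FU FN Ku.
have lim N : exists x, K N x /\
    forall e : R, 0 < e -> \forall n \near F, dist (u n) x <= e.
  have [T [rT Ycpt _]] := iter_Fix_represents N.
  (* Terms before [N] may lie outside [K N]; replacing them is harmless since [F] contains the
     tails. *)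
  have Ku' n : K N (if (N <= n)%N then u n else u N).
    by case: ifP => // Nn; exact: iter_Fix_decreasing (Ku n).
  have [x Kx ux] := rep_ultra_compact rT Ycpt FU Ku'; exists x; split=> // e e0.
  by apply: filterS2 (ux e e0) (FN N) => n /= + Nn; rewrite Nn.
have /choice[x xP] := lim.
have [T [rT _ _]] := iter_Fix_represents 0.
have K0 n : K n `<=` K 0%N by exact: iter_Fix_decreasing.
exists (x 0%N) => [N _|]; last by case: (xP 0%N).
suff -> : x 0%N = x N by case: (xP N).
have Kx n : K 0%N (x n) by apply: (K0 n); case: (xP n).
apply: (rep_dist_eq0 rT) => //; apply/ler_addgt0Pr => e e0; rewrite add0r.
have e2 : 0 < e / 2 by rewrite divr_gt0.
have [n [/= ux0 uxN]] := filter_ex (filterI ((xP 0%N).2 _ e2) ((xP N).2 _ e2)).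
have Kun : K 0%N (u n) by exact: (K0 n).
have := rep_dist_triangle rT (Kx 0%N) Kun (Kx N).
by rewrite (rep_distC rT (Kx 0%N) Kun); lra.
Qed.

Lemma Delta_nonempty : Delta X !=set0.
Proof.
have ex n : exists x, K n x.
  have [T [rT _ _]] := iter_Fix_represents n.
  have [y] := iter_orbit_inhabited n.
  by have [x [Kx _]] := rep_dirac_ex rT y; exists x.
have /choice[u uP] := ex.
have [F [FU FN]] := ultra_nat.
by have [x Dx _] := iter_Fix_limit FU FN uP; exists x.
Qed.

(** Both elements are compared with the Dirac state at one point [a] of the n-th orbit space, each
    at distance at most the diameter. *)
Lemma Delta_dist_le x y n (e : R) : Delta X x -> Delta X y ->
  (pm_diam (iter_orbit X n) <= e%:E)%E -> dist x y <= e + e.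
Proof.
move=> Dx Dy de; have Kx := Dx n I; have Ky := Dy n I.
have [T [rT _ _]] := iter_Fix_represents n.
have [a] := iter_orbit_inhabited n.
have da (b : iter_orbit X n) : pm_dist a b <= e.
  rewrite -lee_fin; apply: le_trans de; apply: ereal_sup_ubound.
  by exists a => //; exists b.
have Tda z : K n z -> T z (pm_dist a) <= e.
  move=> Kz; have sz := rep_state rT Kz; rewrite -[leRHS](state_cst sz).
  by apply: (state_le sz) => //; [exact: lip_dist|exact: lip_cst].
apply: (rep_dist_le rT) => // f f1.
rewrite (le_trans (ler_distD (f a) _ _))// (distrC (f a)) lerD//.
  have := state_at (rep_state rT Kx) a ler01 f1; rewrite mul1r => /le_trans;
    apply.
  exact: Tda.
have := state_at (rep_state rT Ky) a ler01 f1; rewrite mul1r => /le_trans;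
  apply.
exact: Tda.
Qed.

(* Otherwise the Dirac measures at points [a, b] of [X^(n)] with
   [e < d^(n)(a, b)] would accumulate at two distinct elements of [Delta X]. *)
Lemma Delta_singleton_diam mu (e : R) : Delta X = [set mu] -> 0 < e ->
  \forall n \near \oo, (pm_diam (iter_orbit X n) <= e%:E)%E.
Proof.
move=> Dmu e0; apply: contrapT => nnear.
pose A := [set n | (e%:E < pm_diam (iter_orbit X n))%E].
have [N|F [FU FA FN]] := @ultra_eventually A.
  apply: contrapT => nex; apply: nnear; exists N => // n /= Nn.
  by rewrite leNgt; apply/negP => An; apply: nex; exists n.
have ex n : exists p : probability (borel X) R * probability (borel X) R,
    [/\ K n p.1, K n p.2 & A n -> e < dist p.1 p.2].
  have [T [rT _ _]] := iter_Fix_represents n.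
  (* Off [A] a constant pair is a filler, since [iter_Fix_limit] wants an element of [K n] at every
     index. *)
  have [An|nAn] := pselect (A n); last first.
    have [a] := iter_orbit_inhabited n.
    by have [x [Kx _]] := rep_dirac_ex rT a; exists (x, x).
  have [_ [a _ [b _ <-]]] := ereal_sup_gt An; rewrite lte_fin => eab.
  have [x xa] := rep_dirac_ex rT a; have [y yb] := rep_dirac_ex rT b.
  exists (x, y); split; [exact: xa.1|exact: yb.1|] => _ /=.
  by rewrite (dist_dirac2 rT xa yb).
have /choice[p pP] := ex.
have Kp1 n : K n (p n).1 by have [] := pP n.
have Kp2 n : K n (p n).2 by have [] := pP n.
have [x Dx xP] := iter_Fix_limit FU FN Kp1.
have [y Dy yP] := iter_Fix_limit FU FN Kp2.
have xy : y = x by move: Dx Dy; rewrite Dmu /= => -> ->.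
have e2 : 0 < e / 2 by rewrite divr_gt0.
have [n [[/= An xn] yn]] :=
  filter_ex (filterI (filterI FA (xP _ e2)) (yP _ e2)).
have [_ _ /(_ An)] := pP n.
have [T [rT _ _]] := iter_Fix_represents 0.
have Kx : K 0%N x by exact: (Dx 0%N).
have K1 : K 0%N (p n).1 by exact: iter_Fix_decreasing (leq0n n) _ (Kp1 n).
have K2 : K 0%N (p n).2 by exact: iter_Fix_decreasing (leq0n n) _ (Kp2 n).
have := rep_dist_triangle rT K1 Kx K2; rewrite xy in yn.
by rewrite (rep_distC rT Kx K2); lra.
Qed.

End iterated_fixed_points.

Theorem corollary5p6 (R : realType) (X : pointedMetricType R)
  (compactX : compact [set: X]) :
  (exists mu, Delta X = [set mu]) <-> quasi_nilpotent X.
Proof.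
have diam0 n : (0 <= pm_diam (iter_orbit X n))%E.
  have [a] := iter_orbit_inhabited X n; apply: ereal_sup_ubound.
  by exists a => //; exists a => //; rewrite pmxx.
split=> [[mu Dmu]|/fine_cvgP[dfin dcvg]].
  have near_le := Delta_singleton_diam compactX Dmu.
  have near_fin : \forall n \near \oo, pm_diam (iter_orbit X n) \is a fin_num.
    apply: filterS (near_le 1 ltr01) => n d1.
    by rewrite ge0_fin_numE// (le_lt_trans d1)// ltry.
  apply/fine_cvgP; split=> //; apply/cvgrPdist_le => e e0.
  apply: filterS2 near_fin (near_le e e0) => n dfin de /=.
  by rewrite sub0r normrN ger0_norm ?fine_ge0// -lee_fin fineK.
have [x Dx] := Delta_nonempty compactX; exists x; apply/seteqP;
  split=> [y Dy|_ ->//].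
have [T [rT _ _]] := iter_Fix_represents compactX 0.
apply: (rep_dist_eq0 rT); [exact: (Dy 0%N)|exact: (Dx 0%N)|].
apply/ler_addgt0Pr => e e0; rewrite add0r.
(* [Delta_dist_le] costs twice the bound on the diameter. *)
have e2 : 0 < e / 2 by rewrite divr_gt0.
have /cvgrPdist_le/(_ _ e2) near_e := dcvg.
have [n [/= nfin]] := filter_ex (filterI dfin near_e).
rewrite sub0r normrN ger0_norm ?fine_ge0// => ne.
rewrite [leRHS]splitr; apply: (Delta_dist_le compactX (n := n)) => //.
by rewrite -(fineK nfin) lee_fin.
Qed.
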